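(* Let $M$ be a sutured $3$-manifold satisfying the standing hypotheses, $\mathcal{F}$ a taut, transversely oriented depth one foliation of $M$, $\mathcal{L}$ a $1$-dimensional foliation transverse to $\mathcal{F}$ with core lamination $\mathcal{Z}$, $f:L_0\to L_0$ the first return homeomorphism induced by $\mathcal{L}$ on a noncompact leaf $L_0$ of $\mathcal{F}$, and $Z=\mathcal{Z}\cap L_0$. Suppose that the dynamical system $(Z,f)$ admits a Markov partition. Then the cone $\mathcal{C}_f\subset H_1(M)$ is the convex hull of finitely many rays through classes $[\Gamma_i]$, $1\le i\le r$, where the structure cycles $\Gamma_i$ are minimal loops in $\mathcal{Z}$. Consequently, the dual cone $\mathcal{D}_f\subset H^1(M)$ is polyhedral, and both $\mathcal{C}_f$ and $\mathcal{D}_f$ depend only on the symbolic dynamics.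
   Context: Standing hypotheses: $M$ is a compact, connected, oriented sutured $3$-manifold, $\partial M=\partial_\tau M\cup\partial_\pitchfork M$, where $\partial_\pitchfork M$ is the union of the (annular and toral) sutures and $\partial_\tau M\ne\emptyset$ is the union of the remaining, inwardly or outwardly oriented, boundary surfaces; no component of $\partial_\tau M$ is a torus or annulus; $M$ is not a product $S\times I$; and $M$ is completely reduced, i.e. every properly embedded incompressible torus, and every properly embedded incompressible annulus with one boundary circle on an inwardly oriented and the other on an outwardly oriented component of $\partial_\tau M$, is isotopic through surfaces of the same type to a component of $\partial_\pitchfork M$. $M_0=M\setminus\partial_\tau M$. Homology and cohomology have real coefficients. A depth one foliation $\mathcal{F}$ is transverse to $\partial_\pitchfork M$, has as compact leaves exactly the components of $\partial_\tau M$, and fibers $M_0$ over $S^1$ with noncompact fibers. $\mathcal{L}$ is an oriented $1$-dimensional foliation (possibly only $C^0$), transverse to $\mathcal{F}$ (hence to $\partial_\tau M$), tangent to $\partial_\pitchfork M$, inducing the product foliation by compact intervals on annular components of $\partial_\pitchfork M$. Its core lamination $\mathcal{Z}$ is the union of the leaves of $\mathcal{L}$ not meeting $\partial_\tau M$; it is a compact subset of $M_0$. Parametrize $\mathcal{L}|M_0$ as a nonsingular flow $\Phi_t$ using a transverse invariant measure for $\mathcal{F}$, so that $\Phi_1|L_0=f$. Homology directions of $\mathcal{Z}$: the classes of closed orbits in $\mathcal{Z}$, and the limits in $H_1(M)$ of $\frac1{\tau_k}[\Gamma_k^*]$, where $x\in\mathcal{Z}$, $\tau_k\uparrow\infty$,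 the points $\Phi_{\tau_k}(x)$ lie in a common flow box $B$, and $\Gamma_k^*$ is the loop obtained from $\{\Phi_t(x)\}_{0\le t\le\tau_k}$ by adjoining an arc in $B$ from its endpoint back to $x$ (arcs of uniformly bounded length). $\mathcal{C}_f=\mathcal{C}_{\mathcal{Z}}\subset H_1(M)$ is the closure of the set of nonnegative linear combinations of homology directions, and $\mathcal{D}_f=\mathcal{D}_{\mathcal{Z}}\subset H^1(M)$ is its dual cone $\{\alpha:\alpha(c)\ge0\ \forall c\in\mathcal{C}_f\}$. These depend only on $f$. Markov partition for $(Z,f)$: a family $\{R_1,\dots,R_n\}$ of embedded rectangles in $L_0$ with disjoint interiors covering $Z$ (with one pair of opposite edges in the stable set and one pair in the unstable set), with an incidence matrix $A=[a_{ij}]$ of $0$'s and $1$'s and $\Sigma_A=\{(i_k)_{k\in\mathbb{Z}}\in\{1,\dots,n\}^{\mathbb{Z}}: a_{i_ki_{k+1}}=1\ \forall k\}$, shift map $\sigma_A$, such that finite admissible words $i_0\dots i_q$ give subrectangles $\bigcap_{k=0}^q f^{-k}(R_{i_k})$ of $R_{i_0}$, for each $\iota=(i_k)\in\Sigma_A$ the set $R_\iota=\bigcap_{k\in\mathbb{Z}} f^{-k}(R_{i_k})$ is a point, a nondegenerate arc or a nondegenerate rectangle, and $Z=\bigcup_{\iota\in\Sigma_A}R_\iota$. ''Symbolic dynamics'' means the system $(\Sigma_A,\sigma_A)$ associated to the partition. A finite string $i_0,\dots,i_{q-1}$ whose bi-infinite repetition $\iota$ lies in $\Sigma_A$ is a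 period of $\sigma_A$; then there is a periodic orbit $\{x,f(x),\dots,f^q(x)=x\}$ with $x\in R_\iota$ and a corresponding closed leaf $\Gamma_\iota=\{\Phi_t(x)\}$ of $\mathcal{Z}$. A period is minimal if no proper, cyclically consecutive substring of it also occurs as a period; there are finitely many minimal periods. The closed leaves of $\mathcal{Z}$ corresponding to minimal periods are the minimal loops in $\mathcal{Z}$. *)

(* Defs.v *)
From Stdlib Require Import Relation_Operators.
From HB Require Import structures.
From mathcomp Require Import all_boot all_order all_algebra generic_quotient ring_quotient.
From mathcomp Require Import finmap.
From mathcomp Require Import all_classical all_reals all_analysis.
(* the notations of monalg clash with those of analysis *)
From mathcomp.multinomials Require Import -(notations) monalg.
Import Order.TTheory GRing.Theory Num.Theory numFieldNormedType.Exports.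

Set Implicit Arguments.
Unset Strict Implicit.
Unset Printing Implicit Defensive.

Local Open Scope classical_set_scope.
Local Open Scope ring_scope.
Local Open Scope quotient_scope.

(* Homology (ker g)/(im f) of a pair of composable linear maps U -> V -> W, as
   a module. *)
Section Homology.
Variables (K : comNzRingType) (U V W : lmodType K).
Variables (f : {linear U -> V}) (g : {linear V -> W}).

Definition cycle_pred : {pred V} := fun v => g v == 0.

Lemma cycle_submod_closed : submod_closed cycle_pred.
Proof.
split; first by rewrite unfold_in raddf0.
by move=> a x y; rewrite !unfold_in linearP => /eqP-> /eqP->; rewrite scaler0 addr0.
Qed.

HB.instance Definition _ :=
  GRing.isSubmodClosed.Build K V cycle_pred cycle_submod_closed.

Record hcycle := Hcycle { hcycle_val :> V; _ : hcycle_val \in cycle_pred }.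

HB.instance Definition _ := [isSub for hcycle_val].
HB.instance Definition _ := [Choice of hcycle by <:].
HB.instance Definition _ := [SubChoice_isSubLmodule of hcycle by <:].

Lemma cycle_val_is_linear : linear hcycle_val.
Proof. by move=> a x y; rewrite -[LHS]/(val (a *: x + y)) linearP. Qed.
HB.instance Definition _ :=
  GRing.isLinear.Build K hcycle V *:%R hcycle_val cycle_val_is_linear.

Definition boundary_pred : {pred hcycle} :=
  fun z => `[< exists u, f u = hcycle_val z >].

Lemma boundary_submod_closed : submod_closed boundary_pred.
Proof.
split; first by apply/asboolP; exists 0; rewrite raddf0.
move=> a x y /asboolP[u fu] /asboolP[v fv]; apply/asboolP; exists (a *: u + v).
by rewrite !linearP fu fv.
Qed.

HB.instance Definition _ :=
  GRing.isSubmodClosed.Build K hcycle boundary_pred boundary_submod_closed.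

Definition homology := (Quotient.quot boundary_pred).
HB.instance Definition _ := GRing.Zmodule.on homology.
HB.instance Definition _ := EqQuotient.on homology.

Definition homology_class (z : hcycle) : homology := \pi_homology z.

Definition homology_scale (a : K) (h : homology) : homology :=
  homology_class (a *: repr h).

Lemma homology_classP (x y : hcycle) :
  homology_class x = homology_class y <->
  exists u, f u = hcycle_val x - hcycle_val y.
Proof.
rewrite /homology_class; split.
  move/eqP; rewrite -[_ == _]/(\pi_(Quotient.quot boundary_pred) x == \pi_(Quotient.quot boundary_pred) y).
  rewrite -Quotient.idealrBE => /asboolP[u fu]; exists u.
  by rewrite fu raddfB.
move=> [u fu]; apply/eqP.
rewrite -[_ == _]/(\pi_(Quotient.quot boundary_pred) x == \pi_(Quotient.quot boundary_pred) y).
rewrite -Quotient.idealrBE; apply/asboolP; exists u.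
by rewrite fu raddfB.
Qed.

Lemma homology_class_is_zmod_morphism : zmod_morphism homology_class.
Proof. by move=> x y; rewrite /homology_class; exact: (@pi_is_zmod_morphism hcycle). Qed.
HB.instance Definition _ :=
  GRing.isZmodMorphism.Build hcycle homology homology_class
    homology_class_is_zmod_morphism.

Lemma homology_class_scale a z :
  homology_class (a *: z) = homology_scale a (homology_class z).
Proof.
apply/homology_classP.
have /homology_classP[u fu] : homology_class z = homology_class (repr (homology_class z)).
  by rewrite /homology_class reprK.
exists (a *: u); rewrite linearZ /= fu scalerBr.
by rewrite !linearZ_LR.
Qed.

Lemma homology_class_ind (P : homology -> Prop) :
  (forall z, P (homology_class z)) -> forall h, P h.
Proof. by move=> Pz h; rewrite -[h]reprK; exact: Pz. Qed.

Lemma homology_scaleA a b h :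
  homology_scale a (homology_scale b h) = homology_scale (a * b) h.
Proof.
by elim/homology_class_ind: h => z; rewrite -!homology_class_scale scalerA.
Qed.
Lemma homology_scale1 : left_id 1 homology_scale.
Proof. by elim/homology_class_ind => z; rewrite -homology_class_scale scale1r. Qed.
Lemma homology_scaleDr : right_distributive homology_scale +%R.
Proof.
move=> a; elim/homology_class_ind => x; elim/homology_class_ind => y.
by rewrite -raddfD -!homology_class_scale -raddfD scalerDr.
Qed.
Lemma homology_scaleDl h : {morph homology_scale^~ h : a b / a + b}.
Proof.
move=> a b; elim/homology_class_ind: h => z.
by rewrite -!homology_class_scale -raddfD scalerDl.
Qed.
HB.instance Definition _ := GRing.Zmodule_isLmodule.Build K homology
  homology_scaleA homology_scale1 homology_scaleDr homology_scaleDl.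

End Homology.

Section LinearExtension.
Variables (K : comNzRingType) (S : choiceType) (V : lmodType K) (h : S -> V).

Definition lin_ext (c : malg S K) : V := \sum_(s <- msupp c) mcoeff s c *: h s.

Lemma lin_extEw (d : {fset S}) (c : malg S K) : (msupp c `<=` d)%fset ->
  lin_ext c = \sum_(s <- d) mcoeff s c *: h s.
Proof.
move=> le; rewrite /lin_ext (big_fset_incl _ le) // => s _ /mcoeff_outdom ->.
by rewrite scale0r.
Qed.

Lemma lin_ext_is_linear : linear lin_ext.
Proof.
move=> a x y; pose d := (msupp (a *: x + y) `|` (msupp x `|` msupp y))%fset.
rewrite !(@lin_extEw d) /d ?fsubsetUl //.
- rewrite scaler_sumr -big_split; apply: eq_bigr => s _ /=.
  by rewrite mcoeffD mcoeffZ scalerDl scalerA.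
- by rewrite fsubsetU // fsubsetUr orbT.
- by rewrite fsubsetU // fsubsetUl orbT.
Qed.
HB.instance Definition _ :=
  GRing.isLinear.Build K (malg S K) V *:%R lin_ext lin_ext_is_linear.
End LinearExtension.

Section Singular.
Variables (R : realType) (M : topologicalType).

Definition std_simplex (n : nat) : set 'rV[R]_n.+1 :=
  [set v | (forall i, 0 <= v 0 i) /\ \sum_i v 0 i = 1].
Arguments std_simplex : clear implicits.

Definition face_row (n : nat) (i : 'I_n.+2) (v : 'rV[R]_n.+1) : 'rV[R]_n.+2 :=
  \row_j oapp (v 0) 0 (unlift i j).

Lemma face_row_simplex n (i : 'I_n.+2) v : std_simplex n v -> std_simplex n.+1 (face_row i v).
Proof.
move=> [v0 v1]; split=> [j|]; first by rewrite mxE; case: unlift => //= k.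
rewrite (bigD1_ord i) //= mxE unlift_none /= add0r -[RHS]v1.
by apply: eq_bigr => k _; rewrite mxE liftK.
Qed.

Definition simplex_face n (i : 'I_n.+2) (v : std_simplex n) : std_simplex n.+1 :=
  exist _ (face_row i (set_val v))
    (mem_set (face_row_simplex i (set_mem (valP v)))).

Lemma simplex_face_continuous n (i : 'I_n.+2) : continuous (simplex_face i).
Proof.
apply: continuous_comp_initial => v.
apply: (@continuous_comp _ _ _ (set_val : std_simplex n -> _) (face_row i)).
  exact: initial_continuous.
move=> A [P nbhsP PA].
exists (fun _ k => P 0 (lift i k)) => [j k|w Pw].
  by rewrite ord1; have := nbhsP 0 (lift i k); rewrite mxE liftK.
apply: PA => j k; rewrite ord1 mxE; case: unliftP => [k' ->|->] /=.
  exact: Pw 0 k'.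
have := nbhsP 0 i; rewrite mxE unlift_none; exact: nbhs_singleton.
Qed.

Definition simplex n := continuousType (std_simplex n) M.

Lemma face_continuous n (i : 'I_n.+2) (s : simplex n.+1) :
  continuous (s \o simplex_face i).
Proof.
move=> v; apply: continuous_comp; first exact: simplex_face_continuous.
exact: cts_fun.
Qed.

Definition face n (i : 'I_n.+2) (s : simplex n.+1) : simplex n :=
  mkcts (@face_continuous n i s).

Definition sing_chain (K : comNzRingType) n := malg (simplex n) K.

Definition boundary (K : comNzRingType) n : sing_chain K n.+1 -> sing_chain K n :=
  lin_ext (fun s => \sum_(i < n.+2) mkmalgU (face i s) ((-1) ^+ i)).
HB.instance Definition _ (K : comNzRingType) n := GRing.Linear.on (@boundary K n).

Definition H1 := homology (@boundary R 1) (@boundary R 0).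

Definition cochain n := simplex n -> R^o.

Definition coboundary n (a : cochain n) : cochain n.+1 :=
  fun s => \sum_(i < n.+2) (-1) ^+ i * a (face i s).

Lemma coboundary_is_linear n : linear (@coboundary n).
Proof.
move=> k a b; apply/funext => s; rewrite /coboundary.
rewrite [RHS]/GRing.add /= [X in _ = X + _]/GRing.scale /= scaler_sumr -big_split /=.
by apply: eq_bigr => i _; rewrite mulrDr /GRing.scale/= mulrCA.
Qed.
HB.instance Definition _ n :=
  GRing.isLinear.Build R (cochain n) (cochain n.+1) *:%R (@coboundary n) (@coboundary_is_linear n).

Definition coH1 := homology (@coboundary 0) (@coboundary 1).

(* The Kronecker pairing; it does not depend on the chosen representatives. *)
Definition kronecker (a : coH1) (c : H1) : R :=
  lin_ext (hcycle_val (repr a) : cochain 1) (hcycle_val (repr c)).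

(* The class of a path g : [0, 1] -> M as a 1-simplex, provided it is a cycle;
   no c satisfies this if g is not a (continuous) loop. *)
Definition loop_class (g : R -> M) (c : H1) : Prop :=
  exists (s : simplex 1) (z : hcycle (@boundary R 0)),
    [/\ forall v, s v = g (set_val v 0 ord_max),
        hcycle_val z = mkmalgU s 1 & c = homology_class (@boundary R 1) z].
End Singular.
Arguments std_simplex : clear implicits.
Arguments simplex : clear implicits.
Arguments sing_chain : clear implicits.
Arguments H1 : clear implicits.
Arguments coH1 : clear implicits.

(* f restricts to a homeomorphism from A onto B *)
Definition homeo (X Y : topologicalType) (A : set X) (B : set Y) (f : X -> Y) :=
  [/\ set_bij A B f, {within A, continuous f} &
      exists g : Y -> X,
        {within B, continuous g} /\ forall x, A x -> g (f x) = x].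

Definition homeomorphic (X Y : topologicalType) (A : set X) (B : set Y) :=
  exists f : X -> Y, homeo A B f.

Section Models.
Variable R : realType.

Definition circle : set (R * R) := [set v | v.1 ^+ 2 + v.2 ^+ 2 = 1].
Definition disk : set (R * R) := [set v | v.1 ^+ 2 + v.2 ^+ 2 <= 1].
Definition unit_square : set (R * R) := `[0, 1] `*` `[0, 1].
Definition open_square : set (R * R) := `]0, 1[ `*` `]0, 1[.
Definition annulus : set ((R * R) * R) := circle `*` `[0, 1].
Definition torus : set ((R * R) * (R * R)) := circle `*` circle.

Definition rotation (t : R) (v : R * R) : R * R :=
  (cos t * v.1 - sin t * v.2, sin t * v.1 + cos t * v.2).
End Models.
Arguments circle : clear implicits.
Arguments disk : clear implicits.
Arguments unit_square : clear implicits.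
Arguments open_square : clear implicits.
Arguments annulus : clear implicits.
Arguments torus : clear implicits.

(* tau_in and tau_out are the inwardly and outwardly oriented parts of the
   boundary piece d_tau M; pitch is d_pitchfork M. *)
Record sutures (M : Type) :=
  Sutures { tau_in : set M; tau_out : set M; pitch : set M }.

Definition tau M (S : sutures M) : set M := tau_in S `|` tau_out S.
Definition M0 M (S : sutures M) : set M := ~` tau S.
Definition interior_part M (S : sutures M) : set M := ~` (tau S `|` pitch S).

Inductive side := Middle | Inward | Outward.

(* A chart identifies cdom with a box whose face x = 0 (present when on_pitch)
   lies in d_pitchfork M and whose face z = 0 (present when z_side is not
   Middle) lies in d_tau M. The z-axis points into M along tau_in and out of M
   along tau_out. Points of d_tau M /\ d_pitchfork M are corners. *)
Record chart (R : realType) (M : Type) := Chart {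
  cdom : set M;
  crd : M -> R * R * R;
  on_pitch : bool;
  z_side : side }.

Section Sutured.
Variables (R : realType) (M : topologicalType).
Implicit Types (S : sutures M) (c : chart R M) (F L : set (chart R M)).

Definition xyc c q : R * R := (crd c q).1.
Definition zc c q : R := (crd c q).2.

Definition x_range (b : bool) : set R := 
  if b then [set` `[0, 1[] else [set` `]-1, 1[].
Definition z_range (s : side) : set R :=
  match s with
  | Middle => [set` `]-1, 1[]
  | Inward => [set` `[0, 1[]
  | Outward => [set` `]-1, 0]]
  end.
Definition box c : set (R * R * R) :=
  x_range (on_pitch c) `*` `]-1, 1[ `*` z_range (z_side c).

Definition is_chart S c :=
  [/\ open (cdom c), homeo (cdom c) (box c) (crd c) &
      forall q, cdom c q ->
        [/\ tau_in S q <-> z_side c = Inward /\ zc c q = 0,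
            tau_out S q <-> z_side c = Outward /\ zc c q = 0 &
            pitch S q <-> on_pitch c /\ (xyc c q).1 = 0]].

(* Orientations via local homology H_3(M, M \ {x}; Z). *)
Definition avoids n (q : M) (e : sing_chain R M int n) :=
  forall s : simplex R M n, s \in msupp e -> forall v, s v <> q.

Definition rel_homologous (q : M) (e e' : sing_chain R M int 3) :=
  exists d : sing_chain R M int 4, avoids q (e - e' - boundary d).

Definition local_generator (q : M) (e : sing_chain R M int 3) :=
  avoids q (boundary e) /\
  forall e' : sing_chain R M int 3, avoids q (boundary e') ->
    exists m : int, rel_homologous q e' (m *: e).

Definition is_orientation S (mu : M -> sing_chain R M int 3) :=
  (forall q, interior_part S q -> local_generator q (mu q)) /\
  (forall q, interior_part S q ->
     exists e : sing_chain R M int 3, \forall q' \near q,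
       avoids q' (boundary e) /\ rel_homologous q' e (mu q')).

Definition annular_suture S (C : set M) :=
  exists2 h : (R * R) * R -> M, homeo (annulus R) C h &
    forall v, circle R v -> tau_in S (h (v, 0)) /\ tau_out S (h (v, 1)).

Definition sutured_manifold S :=
  [/\ [/\ compact [set: M], hausdorff_space M & connected [set: M]],
      forall q, exists2 c, is_chart S c & cdom c q,
      exists mu, is_orientation S mu &
      forall q, pitch S q ->
        annular_suture S (connected_component (pitch S) q) \/
        homeomorphic (torus R) (connected_component (pitch S) q)].

Definition is_product S :=
  exists (B : topologicalType) (h : B * R -> M),
    homeo ([set: B] `*` [set` `[0, 1]] : set (B * R)%type) [set: M] h /\
    h @` ([set: B] `*` [set 0; 1]) = tau S.

(* X is a (locally flat) surface with boundary X /\ d_tau M, properly embedded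
   and disjoint from d_pitchfork M. *)
Definition proper_surface S (X : set M) :=
  closed X /\
  forall q, X q -> exists c,
    [/\ is_chart S c, cdom c q, on_pitch c = false &
        forall q', cdom c q' -> (X q' <-> (xyc c q').2 = 0)].

Definition incompressible (X : set M) :=
  forall g : R * R -> M, homeo (disk R) (g @` disk R) g ->
    (g @` disk R) `&` X = g @` circle R ->
    exists h : R * R -> M,
      [/\ homeo (disk R) (h @` disk R) h, h @` disk R `<=` X &
          h @` circle R = g @` circle R].

Definition essential_torus S (X : set M) :=
  [/\ proper_surface S X, incompressible X & homeomorphic (torus R) X].

Definition essential_annulus S (X : set M) :=
  [/\ proper_surface S X, incompressible X & annular_suture S X].

(* isotopy of X, parametrized by T, through surfaces of the class E to a
   component of d_pitchfork M *)
Definition isotopic_to_suture S (T : topologicalType) (D : set T)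
    (E : set M -> Prop) (X : set M) :=
  exists H : R * T -> M,
    [/\ {within [set` `[0, 1]] `*` D, continuous H},
        forall t : R, 0 <= t <= 1 -> {in D &, injective (fun v => H (t, v))},
        [set H (0, v) | v in D] = X,
        forall t : R, 0 <= t < 1 -> E [set H (t, v) | v in D] &
        exists2 q, pitch S q &
          [set H (1, v) | v in D] = connected_component (pitch S) q].

Definition completely_reduced S :=
  (forall X, essential_torus S X ->
     isotopic_to_suture S (torus R) (essential_torus S) X) /\
  (forall X, essential_annulus S X ->
     isotopic_to_suture S (annulus R) (essential_annulus S) X).

Definition standing_hypotheses S :=
  [/\ sutured_manifold S, tau S !=set0,
      forall q, tau S q ->
        ~ homeomorphic (torus R) (connected_component (tau S) q) /\
        ~ homeomorphic (annulus R) (connected_component (tau S) q),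
      ~ is_product S & completely_reduced S].

(* Two charts have, locally, the same horizontal plaques z = const with the
   same transverse order. *)
Definition same_horizontal c c' :=
  forall q, cdom c q -> cdom c' q -> exists2 U : set M, nbhs q U &
    forall q1 q2, U q1 -> U q2 -> (zc c q1 <= zc c q2) = (zc c' q1 <= zc c' q2).

(* Two charts have, locally, the same vertical plaques (x, y) = const with the
   same orientation. *)
Definition same_vertical c c' :=
  forall q, cdom c q -> cdom c' q -> exists2 U : set M, nbhs q U &
    forall q1 q2, U q1 -> U q2 ->
      (xyc c q1 = xyc c q2 <-> xyc c' q1 = xyc c' q2) /\
      (xyc c q1 = xyc c q2 -> (zc c q1 <= zc c q2) = (zc c' q1 <= zc c' q2)).

(* A transversely oriented foliation by surfaces, tangent to d_tau M and
   transverse to d_pitchfork M, given by a foliated atlas. *)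
Definition foliation2 S F :=
  [/\ F `<=` is_chart S, forall q, exists2 c, F c & cdom c q &
      forall c c', F c -> F c' -> same_horizontal c c'].

(* An oriented foliation by curves, transverse to d_tau M and tangent to
   d_pitchfork M. *)
Definition foliation1 S L :=
  [/\ L `<=` is_chart S, forall q, exists2 c, L c & cdom c q &
      forall c c', L c -> L c' -> same_vertical c c'].

Definition transverse S F L :=
  forall q, exists c,
    [/\ is_chart S c, cdom c q, forall c', F c' -> same_horizontal c c' &
        forall c', L c' -> same_vertical c c'].

Definition leaf2 F (q : M) : set M :=
  clos_refl_sym_trans M (fun q1 q2 => exists c,
    [/\ F c, cdom c q1, cdom c q2 & zc c q1 = zc c q2]) q.

Definition leaf1 L (q : M) : set M :=
  clos_refl_sym_trans M (fun q1 q2 => exists c,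
    [/\ L c, cdom c q1, cdom c q2 & xyc c q1 = xyc c q2]) q.

(* g is positively transverse to F over the parameter set D *)
Definition transversal_path F (D : set R) (g : R -> M) :=
  {within D, continuous g} /\
  forall t c, D t -> F c -> cdom c (g t) -> exists2 e : R, 0 < e &
    forall s s', D s -> D s' -> `|s - t| < e -> `|s' - t| < e ->
      s < s' -> zc c (g s) < zc c (g s').

Definition taut S F :=
  forall q,
    (exists g : R -> M,
       [/\ transversal_path F setT g, forall t, g (t + 1) = g t &
           exists t, leaf2 F q (g t)]) \/
    (exists g : R -> M,
       [/\ transversal_path F `[0, 1] g, tau_in S (g 0), tau_out S (g 1) &
           exists2 t, 0 <= t <= 1 & leaf2 F q (g t)]).

Definition locally_trivial (D : set M) (p : M -> R * R) :=
  forall v, circle R v -> exists (U : set (R * R)) (h : M -> (R * R) * M),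
    [/\ open U, U v,
        homeo (D `&` p @^-1` U) ((circle R `&` U) `*` (D `&` p @^-1` [set v])) h &
        forall q, D q -> U (p q) -> (h q).1 = p q].

(* p is a fibration of M0 over the circle by the noncompact leaves of F *)
Definition depth_one S F (p : M -> R * R) :=
  [/\ forall q, compact (leaf2 F q) <-> tau S q,
      forall q, tau S q -> leaf2 F q = connected_component (tau S) q,
      {within M0 S, continuous p} /\ p @` M0 S = circle R,
      locally_trivial (M0 S) p &
      forall q, M0 S q -> leaf2 F q = M0 S `&` p @^-1` [set p q]].

Definition product_on_annuli S L :=
  forall q, pitch S q -> annular_suture S (connected_component (pitch S) q) ->
  exists2 h : (R * R) * R -> M,
    homeo (annulus R) (connected_component (pitch S) q) h &
    forall v t, circle R v -> 0 <= t <= 1 ->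
      leaf1 L (h (v, t)) = [set h (v, s) | s in `[0, 1]].

Definition core_lamination S L : set M := [set q | leaf1 L q `&` tau S = set0].

(* Phi parametrizes L|M0 by the transverse invariant measure of F that p pulls
   back from the circle, of total mass 1. *)
Definition leaf_flow S L (p : M -> R * R) (Phi : R -> M -> M) :=
  [/\ {within [set: R] `*` M0 S, continuous (fun tq => Phi tq.1 tq.2)},
      forall q, M0 S q -> Phi 0 q = q /\
        forall s t, Phi (s + t) q = Phi s (Phi t q),
      forall q, M0 S q -> [set Phi t q | t in setT] = leaf1 L q `&` M0 S,
      forall q c, M0 S q -> L c -> cdom c q -> exists2 e : R, 0 < e &
        forall t, 0 < t < e -> cdom c (Phi t q) /\ zc c q < zc c (Phi t q) &
      forall q t, M0 S q -> p (Phi t q) = rotation (2 * pi * t) (p q)].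

Definition first_return (Phi : R -> M -> M) (L0 : set M) (f : M -> M) :=
  forall q, L0 q -> L0 (f q) /\
    exists t : R, [/\ 0 < t, f q = Phi t q &
      forall s, 0 < s < t -> ~ L0 (Phi s q)].
End Sutured.

Section Cones.
Variables (R : realType) (M : topologicalType).
Implicit Types (S : sutures M) (L : set (chart R M)) (Phi : R -> M -> M).

(* the class of the oriented closed leaf through x *)
Definition closed_leaf_class Phi (x : M) (c : H1 R M) :=
  exists T : R,
    [/\ 0 < T, Phi T x = x, forall t, 0 < t < T -> Phi t x <> x &
        loop_class (fun t => Phi (t * T) x) c].

(* Closed boxes of charts adapted to L. Such a B is compact and contractible,
   so the class of a loop closed up by an arc in B does not depend on the arc
   and no bound on the length of the arcs has to be imposed. *)
Definition flow_box S L (B : set M) :=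
  exists c : chart R M,
    [/\ is_chart S c, forall c', L c' -> same_vertical c c' &
        B = [set q | cdom c q /\ `|crd c q| <= 2^-1]].

Definition close_up Phi (x : M) (T : R) (a : R -> M) : R -> M :=
  fun t => if t <= 2^-1 then Phi (2 * t * T) x else a (2 * t - 1).

(* H_1(M) is finite dimensional, hence its topology is the one defined by all
   linear functionals. *)
Definition H1_cvg (c : nat -> H1 R M) (l : H1 R M) :=
  forall phi : {linear H1 R M -> R^o}, (phi \o c) @ \oo --> phi l.

Definition H1_closure (D : set (H1 R M)) : set (H1 R M) :=
  [set c | forall n (phi : 'I_n -> {linear H1 R M -> R^o}) (e : R), 0 < e ->
     exists2 d, D d & forall i, `|phi i c - phi i d| < e].

Definition homology_direction S L Phi (Z : set M) : set (H1 R M) :=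
  [set c | (exists2 x, Z x & closed_leaf_class Phi x c) \/
     exists (x : M) (tk : nat -> R) (B : set M) (a : nat -> R -> M)
            (g : nat -> H1 R M),
       [/\ Z x /\ flow_box S L B,
           [/\ forall k, 0 < tk k, {homo tk : k l / (k < l)%N >-> k < l} &
               tk @ \oo --> +oo],
           B x /\ (forall k, B (Phi (tk k) x)),
           forall k,
             [/\ {within `[0, 1], continuous (a k)}, a k @` `[0, 1] `<=` B,
                 a k 0 = Phi (tk k) x & a k 1 = x] &
           (forall k, loop_class (close_up Phi x (tk k) (a k)) (g k)) /\
           H1_cvg (fun k => (tk k)^-1 *: g k) c]].

(* the convex hull of the rays through the elements of D *)
Definition cone_of (V : lmodType R) (D : set V) : set V :=
  [set v | exists n (a : 'I_n -> R) (d : 'I_n -> V),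
     (forall i, 0 <= a i /\ D (d i)) /\ v = \sum_i a i *: d i].

Definition homology_cone S L Phi (Z : set M) : set (H1 R M) :=
  H1_closure (cone_of (homology_direction S L Phi Z)).

Definition dual_cone (C : set (H1 R M)) : set (coH1 R M) :=
  [set alpha | forall c, C c -> 0 <= kronecker alpha c].

Definition polyhedral (V : lmodType R) (D : set V) :=
  exists n (phi : 'I_n -> {linear V -> R^o}),
    D = [set v | forall i, 0 <= phi i v].
End Cones.

Section Symbolic.
Variables (n : nat) (A : 'M[bool]_n).

Definition Sigma : set (int -> 'I_n) := [set i | forall k, A (i k) (i (k + 1))].

(* the bi-infinite repetition of a nonempty string *)
Definition repetition q (w : q.+1.-tuple 'I_n) : int -> 'I_n :=
  fun k => tnth w (inord `|(k %% q.+1)%Z|%N).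

Definition period q (w : q.+1.-tuple 'I_n) := Sigma (repetition w).

Definition substring q (w : q.+1.-tuple 'I_n) (a l : nat) : l.+1.-tuple 'I_n :=
  [tuple repetition w (a + j)%N | j < l.+1].

(* The substring of length l + 1 starting at position a of the cyclic string w
   occurs in w as a period: it is a period, and on traversing it w returns to
   the symbol it starts with (so that it can be split off from w). *)
Definition occurs_as_period q (w : q.+1.-tuple 'I_n) (a l : nat) :=
  period (substring w a l) /\ repetition w (a + l.+1)%N = repetition w a.

Definition minimal_period q (w : q.+1.-tuple 'I_n) :=
  period w /\ forall a l : nat, (l < q)%N -> ~ occurs_as_period w a l.
End Symbolic.

Section Markov.
Variables (R : realType) (M : topologicalType) (L0 Z : set M) (f : M -> M).

Definition stable_set : set M :=
  [set x | L0 x /\ forall U, open U -> Z `<=` U ->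
     \forall k \near \oo, U (iter k f x)].

Definition unstable_set : set M :=
  [set x | exists o : nat -> M,
     [/\ o 0%N = x, forall k, L0 (o k) /\ f (o k.+1) = o k &
         forall U, open U -> Z `<=` U -> \forall k \near \oo, U (o k)]].

Definition is_arc (X : set M) := homeomorphic (`[0, 1] : set R) X.
Definition is_rectangle (X : set M) := homeomorphic (unit_square R) X.

Definition word_set n (r : 'I_n -> R * R -> M) (q : nat) (i : nat -> 'I_n) : set M :=
  [set x | L0 x /\
     forall k, (k <= q)%N -> (r (i k) @` unit_square R) (iter k f x)].

(* The intersection over k in Z of f^-k(R_(i k)); o is the orbit of x under
   the bijection f of L0. *)
Definition itinerary_set n (r : 'I_n -> R * R -> M) (i : int -> 'I_n) : set M :=
  [set x | exists o : int -> M,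
     o 0 = x /\ forall k, [/\ L0 (o k), f (o k) = o (k + 1) &
                              (r (i k) @` unit_square R) (o k)]].

(* the rectangles R_i are the images of the unit unit_square under r i *)
Definition markov_partition n (r : 'I_n -> R * R -> M) (A : 'M[bool]_n) :=
  [/\ forall i,
        [/\ homeo (unit_square R) (r i @` unit_square R) (r i), r i @` unit_square R `<=` L0,
            r i @` ([set 0; 1] `*` `[0, 1]) `<=` stable_set &
            r i @` (`[0, 1] `*` [set 0; 1]) `<=` unstable_set],
      (forall i j, i <> j ->
         r i @` open_square R `&` r j @` open_square R = set0) /\
      Z `<=` \bigcup_i (r i @` unit_square R),
      forall q (i : nat -> 'I_n), (forall k, (k < q)%N -> A (i k) (i k.+1)) ->
        is_rectangle (word_set r q i),
      forall i, Sigma A i ->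
        [\/ exists x, itinerary_set r i = [set x], is_arc (itinerary_set r i) |
            is_rectangle (itinerary_set r i)] &
      Z = \bigcup_(i in Sigma A) itinerary_set r i].

(* classes of the closed leaves Gamma_iota, iota the repetition of w *)
Definition period_loop_class (Phi : R -> M -> M) n (r : 'I_n -> R * R -> M)
    q (w : q.+1.-tuple 'I_n) (c : H1 R M) :=
  exists x, [/\ itinerary_set r (repetition w) x, iter q.+1 f x = x &
                closed_leaf_class Phi x c].

Definition minimal_loop_class (Phi : R -> M -> M) n (r : 'I_n -> R * R -> M)
    (A : 'M[bool]_n) (c : H1 R M) :=
  exists q (w : q.+1.-tuple 'I_n),
    minimal_period A w /\ period_loop_class Phi r w c.
End Markov.

(* Main.v *)
Require Import Defs.
From Stdlib Require Import Relation_Operators.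
From HB Require Import structures.
From mathcomp Require Import all_boot all_order all_algebra finmap.
From mathcomp Require Import all_classical all_reals all_analysis.
From mathcomp.multinomials Require Import -(notations) monalg.
From mathcomp Require Import lra ring zify.
Import Order.TTheory GRing.Theory Num.Theory numFieldNormedType.Exports.
Set Implicit Arguments.
Unset Strict Implicit.
Unset Printing Implicit Defensive.
Local Open Scope classical_set_scope.
Local Open Scope ring_scope.

(** The idea is to replace homology by a finite weighted graph.

    Singular 1-chains modulo boundaries form a space [chain_quotient] which
    contains H_1(M) and in which every path has a class, additive under
    concatenation and invariant under homotopy ([path_class_triangle],
    [square_homotopy]). A rectangle R_i of the Markov partition, like the domain
    of a chart, is a homeomorphic image of a convex set, so that in it the class
    of a path is the difference of the values of a potential at its endpoints
    ([exact_on]). If A i j = 1, the points of R_i which f sends into R_j form a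
    rectangle, hence a path-connected set; consequently the class of the flow
    arc from such a point y to f y, corrected by the potentials of R_i at y and
    of R_j at f y, does not depend on y ([edge_class_exists]). It is a weight
    E i j on the edge i -> j of the graph of A, and the class of an orbit segment
    is the total weight of the walk given by its itinerary, up to corrections at
    the two endpoints ([flow_class_walk]).

    A closed walk in a finite graph splits into simple cycles, and the simple
    cycles are the minimal periods ([closed_walk_decomposition]), of which there
    are finitely many. The weight of a minimal period is a positive multiple of
    the class of a closed leaf, because the return map has a periodic point with
    this itinerary by Brouwer's theorem in dimension 2
    ([periodic_point_exists], [period_loop_class_sum]). This gives the cone K
    generated by the minimal loops.

    It remains to see that K contains all homology directions. A closed leaf of
    the core lamination runs through a closed walk ([closed_leaf_in_cone]). For a
    limit of long, almost closed orbit segments, one extracts a subsequence along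
    which the last symbol is constant and the endpoints converge; the end
    corrections are then constant, and the loops of the subsequence differ by
    closed walks, that is, by elements of K. After division by the length, every
    linear functional which is nonnegative on K is nonnegative on the limit
    ([asymptotic_cycle_in_cone]), and Farkas' lemma puts the limit in K. The same
    lemma shows that K is closed ([H1_closure_finite_cone]). Finally the dual
    cone is cut out by the Kronecker pairings with the generators. *)

(** * Finitely generated cones *)

Section LinearAlgebra.
Variables (R : realType).

(** By Zorn's lemma there is a maximal subspace X which misses c; maximality makes
    the line through c a complement of X, and the functional is the coordinate
    along c. *)
Lemma functional_separates (V : lmodType R) (c : V) : c != 0 ->
  exists phi : {linear V -> R^o}, phi c = 1.
Proof.
move=> c0.
(* 0 is not required in X, so that the union of an empty chain qualifies *)
pose lin (X : set V) := forall a x y, X x -> X y -> X (a *: x + y).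
have [F FP Ftot|X [[linX Xc] maxX]] :=
    @Zorn_bigcup V [set X | lin X /\ ~ X c].
  split=> [a x y [A FA Ax] [B FB By]|[A FA Ac]]; last by case: (FP _ FA).
  case: (Ftot _ _ FA FB) => [AB|BA].
    by exists B => //; apply: (FP _ FB).1 => //; exact: AB.
  by exists A => //; apply: (FP _ FA).1 => //; exact: BA.
have X0 : X 0.
  apply: contrapT => nX0; apply: (maxX [set 0]); last first.
    split=> [a x y -> ->|/eqP]; first by rewrite scaler0 addr0.
    by rewrite (negbTE c0).
  split=> [x Xx|]; last by move/(_ 0 erefl).
  by case: nX0; rewrite -(addNr x) -scaleN1r; exact: linX.
have XZ a x : X x -> X (a *: x) by move=> Xx; rewrite -[_ *: _]addr0; exact: linX.
have XD x y : X x -> X y -> X (x + y).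
  by move=> Xx Xy; rewrite -[x]scale1r; exact: linX.
have ex v : exists l, X (v - l *: c).
  have [Xv|nXv] := pselect (X v); first by exists 0; rewrite scale0r subr0.
  pose Y := [set w | exists2 s, X s & exists a, w = s + a *: v].
  have Yc : Y c.
    apply: contrapT => nYc; apply: (maxX Y); last first.
      split=> // a _ _ [s Xs [b ->]] [t Xt [d ->]]; exists (a *: s + t).
        exact: linX.
      by exists (a * b + d); rewrite scalerDr scalerDl scalerA addrACA.
    split=> [x Xx|YX]; first by exists x => //; exists 0; rewrite scale0r addr0.
    by apply: nXv; apply: YX; exists 0 => //; exists 1; rewrite scale1r add0r.
  have [s Xs [a ca]] := Yc.
  have a0 : a != 0.
    by apply: contra_notN Xc => /eqP a0; rewrite ca a0 scale0r addr0.
  exists a^-1; rewrite ca scalerDr scalerA mulVf// scale1r.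
  by rewrite opprD addrCA subrr addr0 -scalerN; rewrite -scaleN1r; do 2![apply: (XZ)].
have uni v l m : X (v - l *: c) -> X (v - m *: c) -> l = m.
  move=> Xl Xm; apply/eqP; rewrite -subr_eq0; apply: contra_notT Xc => lm.
  have : X ((l - m)^-1 *: (v - m *: c - (v - l *: c))).
    by apply: (XZ); apply: XD => //; rewrite -scaleN1r; exact: XZ.
  have -> : v - m *: c - (v - l *: c) = (l - m) *: c.
    by rewrite opprB addrC addrA subrK scalerBl.
  by rewrite scalerA mulVf// scale1r.
pose phi v : R^o := xget 0 [set l | X (v - l *: c)].
have phiP v : X (v - (phi v : R) *: c).
  by case: (ex v) => l Xl; apply: (@xgetI _ 0 [set l | X (v - l *: c)] l).
have phi_lin : linear phi.
  move=> a x y; apply: (uni (a *: x + y)) => //.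
  have -> : a *: x + y - (a *: phi x + phi y : R) *: c =
            a *: (x - (phi x : R) *: c) + (y - (phi y : R) *: c).
    by rewrite scalerBr scalerDl opprD addrACA scalerA.
  exact: linX.
pose phiL := GRing.isLinear.Build R V R^o *:%R phi phi_lin.
pose phiH : {linear V -> R^o} := HB.pack phi phiL.
exists phiH; apply: (uni c) => //=.
by rewrite scale1r subrr.
Qed.

Section Cone.
Variables (V : lmodType R).
Implicit Types (D : set V) (s : seq V).

Lemma cone_of_gen D : D `<=` cone_of D.
Proof.
move=> x Dx; exists 1%N, (fun=> 1), (fun=> x); split=> [i|]; first by split.
by rewrite big_ord1 scale1r.
Qed.

Lemma cone_of0 D : cone_of D 0.
Proof.
exists 0%N, (fun=> 0), (fun=> 0); split=> [[]//|]; by rewrite big_ord0.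
Qed.

Lemma cone_ofD D x y : cone_of D x -> cone_of D y -> cone_of D (x + y).
Proof.
move=> [m [a [d [ad ->]]]] [n [b [e [be ->]]]].
exists (m + n)%N,
  (fun i : 'I_(m + n) => match fintype.split i with inl j => a j | inr j => b j end),
  (fun i : 'I_(m + n) => match fintype.split i with inl j => d j | inr j => e j end).
split=> [i|]; first by case: (fintype.split i).
rewrite big_split_ord /=; congr (_ + _); apply: eq_bigr => i _.
  by rewrite (unsplitK (inl i)).
by rewrite (unsplitK (inr i)).
Qed.

Lemma cone_ofZ D k x : 0 <= k -> cone_of D x -> cone_of D (k *: x).
Proof.
move=> k0 [m [a [d [ad ->]]]]; exists m, (fun i => k * a i), d; split=> [i|].
  by have [a0 Dd] := ad i; split=> //; exact: mulr_ge0.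
by rewrite scaler_sumr; apply: eq_bigr => i _; rewrite scalerA.
Qed.

Lemma cone_of_min D D' : D `<=` cone_of D' -> cone_of D `<=` cone_of D'.
Proof.
move=> DD' _ [m [a [d [ad ->]]]]; elim/big_ind: _ => [|x y|i _].
- exact: cone_of0.
- exact: cone_ofD.
- by have [a0 Dd] := ad i; apply: cone_ofZ => //; exact: DD'.
Qed.

Lemma cone_of_ge0 D (phi : {linear V -> R^o}) :
  (forall d, D d -> 0 <= phi d) -> forall c, cone_of D c -> 0 <= phi c.
Proof.
move=> D0 _ [m [a [d [ad ->]]]].
rewrite linear_sum sumr_ge0// => i _.
have [a0 Dd] := ad i; rewrite linearZ.
by apply: mulr_ge0 => //; exact: D0.
Qed.

Lemma cone_of_cons d s v k : cone_of [set` s] v -> 0 <= k ->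
  cone_of [set` d :: s] (v + k *: d).
Proof.
move=> sv k0; apply: cone_ofD.
  apply: cone_of_min sv => x /= xs; apply: cone_of_gen => /=.
  by rewrite inE xs orbT.
by apply: cone_ofZ => //; apply: cone_of_gen; rewrite /= inE eqxx.
Qed.

Lemma cone_of_map (W : lmodType R) (f : {linear V -> W}) s w :
  cone_of [set` map f s] w -> exists2 v, cone_of [set` s] v & f v = w.
Proof.
move=> [m [a [d [ad ->]]]].
have /choice[e eP] i : exists e, e \in s /\ f e = d i.
  by have [_ /= /mapP[e es ->]] := ad i; exists e.
exists (\sum_i a i *: e i); last first.
  by rewrite linear_sum; apply: eq_bigr => i _; rewrite linearZ (eP i).2.
exists m, a, e; split=> // i; split; first by case: (ad i).
exact: (eP i).1.
Qed.

End Cone.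

(** Induction on the number of generators. If the functional phi found for s is
    negative on the new generator d, project V onto the kernel of phi along d. A
    functional which separates the projections of c and of s also does so after
    composition with the projection, as it then vanishes on d. If there is none,
    the projection of c is that of some v in the cone of s, and c - v is a
    multiple of d whose sign is given by phi c < 0 <= phi v. *)
Lemma farkas (V : lmodType R) (s : seq V) (c : V) : ~ cone_of [set` s] c ->
  exists phi : {linear V -> R^o}, (forall d, d \in s -> 0 <= phi d) /\ phi c < 0.
Proof.
have [k] := ubnP (size s); elim: k s c => // k IHk [|d s] c sk ncone.
  have c0 : c != 0.
    by apply: contra_notN ncone => /eqP ->; exact: cone_of0.
  have nc0 : - c != 0 by rewrite oppr_eq0.
  have [phi phic] := functional_separates nc0.
  exists phi; split=> //; move: phic; rewrite raddfN => /eqP.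
  by rewrite eqr_oppLR => /eqP ->; rewrite oppr_lt0.
have [sc|nsc] := pselect (cone_of [set` s] c).
  case: ncone; rewrite -[c]addr0 -(scale0r d).
  exact: cone_of_cons.
have [phi [phis phic]] := IHk s c sk nsc.
have [phid|phid] := leP 0 (phi d).
  exists phi; split=> // e; rewrite inE => /predU1P[->//|]; exact: phis.
pose l := (- phi d)^-1.
have l0 : 0 < l by rewrite invr_gt0 oppr_gt0.
pose pr v : V := v + (l * phi v : R) *: d.
have pr_lin : linear pr.
  move=> a x y; rewrite /pr linearP/= scalerDr addrACA; congr (_ + _).
  by rewrite scalerA -scalerDl mulrDr mulrCA.
pose prL := GRing.isLinear.Build R V V *:%R pr pr_lin.
pose prH : {linear V -> V} := HB.pack pr prL.
have prd : pr d = 0.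
  rewrite /pr -[X in X + _]scale1r -scalerDl /l invrN mulNr mulVf ?subrr ?scale0r//.
  by rewrite lt_eqF.
have [prc|] := pselect (cone_of [set` map prH s] (prH c)); last first.
  move=> /IHk[|psi [psis psic]]; first by rewrite size_map.
  exists (psi \o prH); split=> // e; rewrite inE => /predU1P[->|es] /=.
    by rewrite prd linear0.
  by apply: psis; apply: map_f.
have [v sv prv] := cone_of_map prc.
case: ncone.
have -> : c = v + (l * (phi v - phi c)) *: d.
  rewrite mulrBr scalerBl addrA -[v + _]/(pr v) [pr v]prv /= /pr.
  by rewrite addrK.
apply: cone_of_cons => //; apply: mulr_ge0; first exact: ltW.
rewrite subr_ge0 (le_trans (ltW phic))//.
exact: (cone_of_ge0 phis sv).
Qed.

(** A point outside the cone is cut off by a functional, and every functional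
    defines neighbourhoods in the topology of [H1_closure]. *)
Lemma H1_closure_finite_cone (M : topologicalType) (s : seq (H1 R M)) :
  H1_closure (cone_of [set` s]) `<=` cone_of [set` s].
Proof.
move=> c cl; apply: contrapT => /farkas[phi [phis phic]].
have [|d sd /(_ ord0)] := cl 1%N (fun=> phi) (- phi c); first by rewrite oppr_gt0.
have := cone_of_ge0 phis sd.
move=> d0; rewrite distrC ger0_norm ?subr_ge0 ?(le_trans (ltW phic))//.
by rewrite ltrBlDr addNr ltNge d0.
Qed.
End LinearAlgebra.

(** * The Kronecker pairing *)

Lemma homology_class_linear (K : comNzRingType) (U V W : lmodType K)
  (f : {linear U -> V}) (g : {linear V -> W}) :
  linear (@homology_class K U V W f g).
Proof. by move=> a x y; rewrite raddfD; congr (_ + _); exact: homology_class_scale. Qed.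

Section Kronecker.
Variables (R : realType) (M : topologicalType).

Lemma lin_extU (K : comNzRingType) (S : choiceType) (V : lmodType K) (h : S -> V)
  s a : lin_ext h (mkmalgU s a) = a *: h s.
Proof. by rewrite (lin_extEw _ msuppU_le) big_seq_fset1 mcoeffUU. Qed.

(** Stokes' formula, from which the pairing of classes can be computed on any
    representatives. *)
Lemma lin_ext_boundary n (b : cochain R M n) (u : sing_chain R M R n.+1) :
  lin_ext b (boundary u) = lin_ext (coboundary b) u.
Proof.
rewrite /boundary /lin_ext -/(lin_ext b _) linear_sum; apply: eq_bigr => s _.
rewrite linearZ linear_sum /coboundary; congr (_ *: _).
by apply: eq_bigr => i _; rewrite -[LHS]/(lin_ext b _) lin_extU.
Qed.

Lemma kronecker_class (a : hcycle (@coboundary R M 1)) (z : hcycle (@boundary R M R 0)) :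
  kronecker (homology_class (@coboundary R M 0) a) (homology_class (@boundary R M R 1) z)
  = lin_ext (hcycle_val a) (hcycle_val z).
Proof.
rewrite /kronecker; set a' := repr _; set z' := repr _.
have /homology_classP[b ba] : homology_class (@coboundary R M 0) a' = homology_class _ a.
  by rewrite /homology_class reprK.
have /homology_classP[u uz] : homology_class (@boundary R M R 1) z' = homology_class _ z.
  by rewrite /homology_class reprK.
have bz (y : hcycle (@boundary R M R 0)) : boundary (hcycle_val y) = 0.
  by case: y => y /= /eqP.
have ca (y : hcycle (@coboundary R M 1)) : coboundary (hcycle_val y) = 0.
  by case: y => y /= /eqP.
transitivity (lin_ext (hcycle_val a) (hcycle_val z')).
  apply/eqP; rewrite -subr_eq0; apply/eqP.
  transitivity (lin_ext (coboundary b) (hcycle_val z')).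
    rewrite ba /lin_ext -sumrB; apply: eq_bigr => s _.
    by rewrite -scalerBr.
  by rewrite -lin_ext_boundary bz linear0.
apply/eqP; rewrite -subr_eq0 -linearB -uz.
rewrite -[X in X == 0]/(lin_ext (hcycle_val a) (boundary u)) lin_ext_boundary ca /lin_ext.
by rewrite big1// => s _; rewrite scaler0.
Qed.

Lemma kronecker_linearr (alpha : coH1 R M) :
  linear (kronecker alpha : H1 R M -> R^o).
Proof.
elim/homology_class_ind: alpha => a k.
elim/homology_class_ind => x; elim/homology_class_ind => y.
by rewrite -homology_class_linear !kronecker_class !linearP.
Qed.

Lemma kronecker_linearl (c : H1 R M) :
  linear ((fun alpha : coH1 R M => kronecker alpha c) : coH1 R M -> R^o).
Proof.
elim/homology_class_ind: c => z k.
elim/homology_class_ind => x; elim/homology_class_ind => y.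
rewrite -homology_class_linear !kronecker_class linearP.
rewrite /lin_ext scaler_sumr -big_split; apply: eq_bigr => s _ /=.
by rewrite scalerA mulrC -scalerA -scalerDr.
Qed.
End Kronecker.

(** * Classes of paths in chains modulo boundaries *)

Section ChainClasses.
Variables (R : realType) (M : topologicalType).

(** 1-chains modulo boundaries, written as the homology of a complex with second
    map zero. A path which is not a loop has a class here, so that the class of a
    loop can be computed piece by piece. *)
Definition chain_quotient :=
  homology (@boundary R M R 1) (\0 : {linear sing_chain R M R 1 -> sing_chain R M R 1}).

Lemma null_cycle (z : sing_chain R M R 1) :
  z \in cycle_pred (\0 : {linear sing_chain R M R 1 -> sing_chain R M R 1}).
Proof. by apply/eqP. Qed.

Definition chain_class (z : sing_chain R M R 1) : chain_quotient :=
  homology_class _ (Hcycle (null_cycle z)).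

Lemma chain_class_is_linear : linear chain_class.
Proof.
move=> a x y; rewrite /chain_class -homology_class_linear; congr homology_class.
exact: val_inj.
Qed.
HB.instance Definition _ := GRing.isLinear.Build R _ _ *:%R chain_class chain_class_is_linear.

Lemma chain_class_boundary u : chain_class (boundary u) = 0.
Proof.
rewrite -(linear0 chain_class); apply/homology_classP; exists u.
by rewrite /= subr0.
Qed.

(** The inclusion of H_1(M) into [chain_quotient]. *)
Definition h1_chain (c : H1 R M) : chain_quotient := chain_class (hcycle_val (repr c)).

Lemma h1_chainE z : h1_chain (homology_class (@boundary R M R 1) z) = chain_class (hcycle_val z).
Proof.
rewrite /h1_chain; set z' := repr _.
have /homology_classP[u uz] : homology_class (@boundary R M R 1) z' = homology_class _ z.
  by rewrite /homology_class reprK.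
apply/eqP; rewrite -subr_eq0 -linearB -uz; apply/eqP.
exact: chain_class_boundary.
Qed.

Lemma h1_chain_is_linear : linear h1_chain.
Proof.
move=> a; elim/homology_class_ind => x; elim/homology_class_ind => y.
by rewrite -homology_class_linear !h1_chainE -linearP.
Qed.
HB.instance Definition _ := GRing.isLinear.Build R _ _ *:%R h1_chain h1_chain_is_linear.

Lemma h1_chain_inj : injective h1_chain.
Proof.
elim/homology_class_ind => x; elim/homology_class_ind => y.
by rewrite !h1_chainE => /homology_classP[u uxy]; apply/homology_classP; exists u.
Qed.

(** The value 0 at discontinuous maps makes [path_class] a total function of the
    path. *)
Definition chain_of_map n (u : std_simplex R n -> M) : sing_chain R M R n :=
  match pselect (continuous u) with
  | left c => mkmalgU (mkcts c : simplex R M n) 1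
  | right _ => 0
  end.

Lemma chain_of_mapE n (s : simplex R M n) (u : std_simplex R n -> M) : s =1 u ->
  chain_of_map u = mkmalgU s 1.
Proof.
move=> su; rewrite /chain_of_map; case: pselect => [c|[]]; last first.
  have <- : (s : _ -> _) = u by exact/funext.
  exact: cts_fun.
by congr (mkmalgU _ _); apply/continuousEP => v /=; rewrite su.
Qed.

Lemma boundary_chain_of_map n (u : std_simplex R n.+1 -> M) : continuous u ->
  boundary (chain_of_map u) = \sum_(i < n.+2) (-1) ^+ i *: chain_of_map (u \o simplex_face i).
Proof.
move=> c; pose s : simplex R M n.+1 := mkcts c.
rewrite (chain_of_mapE (s := s))// /boundary lin_extU scale1r; apply: eq_bigr => i _.
rewrite (chain_of_mapE (s := face i s))//; apply/malgP => t.
by rewrite mcoeffZ !mcoeffU -mulr_natr -[1 *+ _]mulr_natr mul1r.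
Qed.

Definition edge_coord (v : std_simplex R 1) : R := set_val v 0 ord_max.

Definition path_class (g : R -> M) : chain_quotient :=
  chain_class (chain_of_map (g \o edge_coord)).

Lemma edge_coord_itv v : edge_coord v \in `[0, 1].
Proof.
rewrite /edge_coord; have [v0 v1] := set_mem (valP v).
rewrite in_itv /= v0 /= -v1 big_ord_recr /= lerDr sumr_ge0//.
Qed.

Lemma eq_path_class (g g' : R -> M) : {in `[0, 1], g =1 g'} ->
  path_class g = path_class g'.
Proof.
move=> gg'; rewrite /path_class; congr (chain_class (chain_of_map _)).
by apply/funext => v /=; apply: gg'; exact: edge_coord_itv.
Qed.

Lemma loop_class_path (g : R -> M) (c : H1 R M) : loop_class g c ->
  h1_chain c = path_class g.
Proof.
move=> [s [z [sg zs ->]]]; rewrite h1_chainE zs /path_class; congr chain_class.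
by apply/esym/chain_of_mapE.
Qed.

Lemma simplex_coord_continuous n k :
  continuous (fun v : std_simplex R n => set_val v 0 k).
Proof.
move=> v; apply: (@continuous_comp _ _ _ (set_val : std_simplex R n -> _)
   (fun x : 'rV[R]_n.+1 => x 0 k)).
  exact: initial_continuous.
exact: coord_continuous.
Qed.

Lemma edge_coord_continuous : continuous edge_coord.
Proof. exact: simplex_coord_continuous. Qed.

Lemma within_comp (T U V : topologicalType) (A : set T) (B : set U)
   (f : T -> U) (g : U -> V) :
  {within A, continuous f} -> {within B, continuous g} -> (forall x, A x -> B (f x)) ->
  {within A, continuous (g \o f)}.
Proof.
move=> /subspace_continuousP cf /subspace_continuousP cg AB.
apply/subspace_continuousP => x Ax.
apply: (@cvg_comp _ _ _ f g _ (within B (nbhs (f x)))); last exact/cg/AB.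
move=> P nP; have := cf x Ax _ nP.
rewrite /within /nbhs /=; apply: filterS => y + Ay; apply => //; exact: AB.
Qed.

Lemma continuous_corestrict (T U V : topologicalType) (B : set U)
   (f : T -> U) (g : U -> V) :
  continuous f -> {within B, continuous g} -> (forall x, B (f x)) -> continuous (g \o f).
Proof.
move=> cf cg fB; apply/continuous_subspace_setT.
apply: (within_comp (A := setT) _ cg) => [|x _]; last exact: fB.
exact: (continuous_subspace_setT f).1.
Qed.

Lemma path_edge_continuous (g : R -> M) : {within `[0, 1], continuous g} ->
  continuous (g \o edge_coord).
Proof.
move=> cg; apply: continuous_corestrict cg _; first exact: edge_coord_continuous.
exact: edge_coord_itv.
Qed.

(** The vertices are indexed by nat, so that passing to a face is a reindexing
    of P. *)
Definition affine (E : lmodType R) (P : nat -> E) n (v : std_simplex R n) : E :=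
  \sum_(k < n.+1) set_val v 0 k *: P k.

Arguments affine {E} P {n} v.

Lemma affine_face (E : lmodType R) (P : nat -> E) n (i : 'I_n.+2) (v : std_simplex R n) :
  affine P (simplex_face i v) = affine (fun k => P (bump i k)) v.
Proof.
rewrite /affine (bigD1_ord i)//= mxE unlift_none scale0r add0r.
by apply: eq_bigr => k _; rewrite mxE liftK.
Qed.

Lemma affine_continuous (E : normedModType R) (P : nat -> E) n :
  continuous (affine P : std_simplex R n -> E).
Proof.
apply: (@continuous_big _ _ +%R 0 xpredT); first exact: add_continuous.
move=> k _ v; apply: (@continuous_comp _ _ _ (fun w : std_simplex R n => set_val w 0 k)
   (fun x : R => x *: P k)); first exact: simplex_coord_continuous.
by apply: cvgZr_tmp; exact: cvg_id.
Qed.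

Definition seg (E : lmodType R) (a b : E) (t : R) : E := (1 - t) *: a + t *: b.

Lemma affine1 (E : lmodType R) (P : nat -> E) (v : std_simplex R 1) :
  affine P v = seg (P 0%N) (P 1%N) (edge_coord v).
Proof.
rewrite /affine /seg /edge_coord big_ord_recr big_ord1 /=.
have [_] := set_mem (valP v); rewrite big_ord_recr big_ord1 /= => <-.
rewrite addrK; congr (_ *: _ + _); congr (set_val v _ _); exact: val_inj.
Qed.

Definition convex (E : lmodType R) (D : set E) :=
  forall a b t, D a -> D b -> 0 <= t <= 1 -> D (seg a b t).

(** Convexity only speaks of segments: the point is on the segment from P 0 to a
    point of the opposite side. *)
Lemma affine2_convex (E : lmodType R) (D : set E) (P : nat -> E) (v : std_simplex R 2) :
  convex D -> (forall k, D (P k)) -> D (affine P v).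
Proof.
move=> cD DP; have [v0 v1] := set_mem (valP v).
move: v1; rewrite /affine !big_ord_recr !big_ord0 /= !add0r.
set x := set_val v 0 _; set y := set_val v 0 _; set z := set_val v 0 _ => xyz.
have [x0 y0 z0] : [/\ 0 <= x, 0 <= y & 0 <= z] by split; exact: v0.
clearbody x y z.
have xE : x = 1 - (y + z) by rewrite -xyz -addrA addrK.
have [yz0|yz0] := eqVneq (y + z) 0.
  have /eqP := yz0; rewrite paddr_eq0// => /andP[/eqP y00 /eqP z00].
  rewrite xE yz0 y00 z00 subr0 scale1r !scale0r !addr0; exact: DP.
have yzp : 0 < y + z by rewrite lt_neqAle eq_sym yz0 addr_ge0.
have -> : x *: P 0%N + y *: P 1%N + z *: P 2%N =
    seg (P 0%N) (seg (P 1%N) (P 2%N) (z / (y + z))) (y + z).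
  rewrite /seg -xE -addrA scalerDr !scalerA; congr (_ + (_ *: _ + _ *: _)); field => //.
apply: (cD) => //; last by rewrite addr_ge0//= -xyz -addrA lerDr.
by apply: cD => //; rewrite divr_ge0 ?addr_ge0//= ler_pdivrMr// mul1r lerDr.
Qed.

Section Convex.
Variables (E : normedModType R) (D : set E) (G : E -> M).
Hypothesis convD : convex D.
Hypothesis cG : {within D, continuous G}.

(** The three paths bound the image by G of the affine triangle a b c. All the
    homotopies below come down to this lemma for a suitable D. *)
Lemma path_class_triangle a b c : D a -> D b -> D c ->
  path_class (G \o seg a b) + path_class (G \o seg b c) = path_class (G \o seg a c).
Proof.
move=> Da Db Dc; pose P k := nth a [:: a; b; c] k.
have DP k : D (P k) by case: k => [|[|[|k]]]//; rewrite /P nth_default.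
pose u : std_simplex R 2 -> M := G \o affine P.
have cu : continuous u.
  apply: continuous_corestrict cG _; first exact: affine_continuous.
  by move=> v; exact: affine2_convex.
have := chain_class_boundary (chain_of_map u).
rewrite boundary_chain_of_map// linear_sum !big_ord_recr big_ord0 /=.
have faceE (i : 'I_3) : u \o simplex_face i =
    (G \o seg (P (bump i 0)) (P (bump i 1))) \o edge_coord.
  apply/funext => v; transitivity (G (affine P (simplex_face i v))) => //.
    by rewrite affine_face affine1.
rewrite !faceE /= /bump /= !linearZ /= expr0 expr1 sqrrN expr1n scale1r scaleN1r scale1r add0r.
rewrite -!/(path_class _) addrAC => /eqP; rewrite subr_eq0 addrC => /eqP.
exact.
Qed.

Lemma path_class_cst a : D a -> path_class (fun=> G a) = 0.
Proof.
move=> Da; have := path_class_triangle Da Da Da.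
have -> : G \o seg a a = fun=> G a.
  by apply/funext => t; rewrite /= /seg -scalerDl subrK scale1r.
by move/eqP; rewrite -subr_eq0 addrK => /eqP.
Qed.
End Convex.
End ChainClasses.

(** * Homotopies and potentials *)

Section Paths.
Variables (R : realType) (M : topologicalType).
Local Notation path_class := (@path_class R M).

Let i0 : (0 : R) \in `[0, 1]. Proof. by rewrite in_itv /= lexx ler01. Qed.
Let i1 : (1 : R) \in `[0, 1]. Proof. by rewrite in_itv /= lexx ler01. Qed.

Definition path_in (X : set M) (b : R -> M) :=
  {within `[0, 1], continuous b} /\ forall t, t \in `[0, 1] -> X (b t).

Lemma segE (a b t : R) : seg a b t = a + t * (b - a).
Proof. rewrite /seg; have sE (x y : R) : x *: y = x * y by []. rewrite !sE; ring. Qed.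

Lemma seg01 (t : R) : seg 0 1 t = t.
Proof. by rewrite segE subr0 mulr1 add0r. Qed.

Lemma seg0 (E : lmodType R) (a b : E) : seg a b 0 = a.
Proof. by rewrite /seg subr0 scale1r scale0r addr0. Qed.

Lemma seg1 (E : lmodType R) (a b : E) : seg a b 1 = b.
Proof. by rewrite /seg subrr scale0r scale1r add0r. Qed.

Lemma seg_itv (a b x y t : R) : x \in `[a, b] -> y \in `[a, b] -> t \in `[0, 1] ->
  seg x y t \in `[a, b].
Proof.
rewrite !in_itv /= => /andP[ax xb] /andP[ay yb] /andP[t0 t1]; rewrite segE.
by apply/andP; split; nra.
Qed.

Lemma convex_itv (a b : R) : convex (`[a, b] : set R).
Proof. by move=> x y t /= xab yab t01; apply: seg_itv. Qed.

Lemma convexX (E F : lmodType R) (A : set E) (B : set F) :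
  convex A -> convex B -> convex (A `*` B).
Proof. by move=> cA cB [a b] [a' b'] t [/= Aa Bb] [/= Aa' Bb'] t01; split; [exact: cA|exact: cB]. Qed.

Lemma seg_pair (E F : lmodType R) (a a' : E) (b b' : F) t :
  seg (a, b) (a', b') t = (seg a a' t, seg b b' t).
Proof. by []. Qed.

Lemma seg_id (E : lmodType R) (a : E) t : seg a a t = a.
Proof. by rewrite /seg -scalerDl subrK scale1r. Qed.

(** Both sides are equal to the class of the diagonal. *)
Lemma square_homotopy (H : R * R -> M) : {within unit_square R, continuous H} ->
  path_class (fun t => H (0, t)) + path_class (fun s => H (s, 1)) =
  path_class (fun s => H (s, 0)) + path_class (fun t => H (1, t)).
Proof.
move=> cH.
have cv : convex (unit_square R) by apply: convexX; exact: convex_itv.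
have in_sq (x y : R) : x \in `[0, 1] -> y \in `[0, 1] -> unit_square R (x, y) by [].
have := path_class_triangle cv cH (in_sq 0 0 i0 i0) (in_sq 0 1 i0 i1) (in_sq 1 1 i1 i1).
have := path_class_triangle cv cH (in_sq 0 0 i0 i0) (in_sq 1 0 i1 i0) (in_sq 1 1 i1 i1).
move=> <-; congr (_ + _ = _ + _); apply: eq_path_class => t _ /=;
  by rewrite seg_pair ?seg_id ?seg01.
Qed.

Lemma path_class_const (x : M) : path_class (fun=> x) = 0.
Proof.
apply: (@path_class_cst R M R setT (fun=> x) _ _ 0) => //.
by apply: continuous_subspaceT => y; exact: cvg_cst.
Qed.

Lemma seg_within (E : normedModType R) (T : topologicalType) (A : set T)
    (f g : T -> E) (h : T -> R) :
  {within A, continuous f} -> {within A, continuous g} -> {within A, continuous h} ->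
  {within A, continuous (fun x => seg (f x) (g x) (h x))}.
Proof.
move=> cf cg ch x; apply: cvgD; apply: cvgZ => //; last 2 first.
- exact: ch.
- exact: cg.
- apply: cvgB; first exact: cvg_cst.
  exact: ch.
- exact: cf.
Qed.

Lemma within_fst (T U : topologicalType) (A : set (T * U)) : {within A, continuous fst}.
Proof. by apply: continuous_subspaceT => x; exact: cvg_fst. Qed.

Lemma within_snd (T U : topologicalType) (A : set (T * U)) : {within A, continuous snd}.
Proof. by apply: continuous_subspaceT => x; exact: cvg_snd. Qed.

(** The straight-line homotopy in D from b to the segment between its endpoints. *)
Lemma path_class_convex (E : normedModType R) (D : set E) (G : E -> M) (b : R -> E) :
  convex D -> {within D, continuous G} -> {within `[0, 1], continuous b} ->
  (forall t, t \in `[0, 1] -> D (b t)) ->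
  path_class (G \o b) = path_class (G \o seg (b 0) (b 1)).
Proof.
move=> cD cG cb Db.
pose c (st : R * R) := seg (b st.2) (seg (b 0) (b 1) st.2) st.1.
have cc : {within unit_square R, continuous c}.
  apply: seg_within; last exact: within_fst.
    by apply: within_comp cb _; [exact: within_snd|move=> [? ?] []].
  apply: seg_within; last exact: within_snd.
    by apply: continuous_subspaceT => x; exact: cvg_cst.
  by apply: continuous_subspaceT => x; exact: cvg_cst.
have := @square_homotopy (G \o c); rewrite -[X in _ + X = _ + _]/(path_class _).
have -> : path_class (fun s => (G \o c) (s, 1)) = 0.
  rewrite -(path_class_const (G (b 1))); apply: eq_path_class => s _ /=.
  by rewrite /c /= seg1 seg_id.
have -> : path_class (fun s => (G \o c) (s, 0)) = 0.
  rewrite -(path_class_const (G (b 0))); apply: eq_path_class => s _ /=.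
  by rewrite /c /= seg0 seg_id.
rewrite addr0 add0r => H.
transitivity (path_class (fun t => (G \o c) (0, t))).
  by apply: eq_path_class => t _; rewrite /= /c /= seg0.
rewrite H; last first.
  apply: within_comp cG _ => // -[s t] [/= s01 t01].
  apply: (cD) => //; first exact: Db.
  by apply: cD => //; exact: Db.
by apply: eq_path_class => t _; rewrite /= /c /= seg1.
Qed.

(** In a simply connected set the class of a path depends only on its endpoints.
    A potential expresses this additively and spares the choice of paths. *)
Definition exact_on (X : set M) := exists F : M -> chain_quotient R M,
  forall b, path_in X b -> path_class b = F (b 1) - F (b 0).

(** The potential at x is the class of the image of the segment from a base point
    of D to g x. *)
Lemma exact_cell (E : normedModType R) (D : set E) (X : set M) (G : E -> M) (g : M -> E) :
  convex D -> {within D, continuous G} -> {within X, continuous g} ->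
  (forall x, X x -> D (g x) /\ G (g x) = x) -> exact_on X.
Proof.
move=> cD cG cg gX.
have [[d Dd]|nD] := pselect (D !=set0); last first.
  exists (fun=> 0) => b [_ bX]; case: nD; exists (g (b 0)).
  by apply: (gX _ _).1; exact: bX.
exists (fun x => path_class (G \o seg d (g x))) => b [cb bX].
have -> : path_class b = path_class (G \o (g \o b)).
  by apply: eq_path_class => t t01 /=; rewrite (gX _ _).2//; exact: bX.
rewrite (path_class_convex cD cG); last 2 first.
- exact: within_comp cb cg bX.
- by move=> t /bX/gX[].
have Dgb t : t \in `[0, 1] -> D (g (b t)) by move=> /bX/gX[].
rewrite /= -(path_class_triangle cD cG Dd (Dgb 0 i0) (Dgb 1 i1)).
by rewrite addrAC subrr add0r.
Qed.

Lemma exact_homeo (E : normedModType R) (D : set E) (X : set M) (G : E -> M) :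
  convex D -> homeo D X G -> exact_on X.
Proof.
move=> cD [[GX _ Gsurj] cG [g [cg gK]]]; apply: (exact_cell cD cG cg) => x Xx.
by have [d Dd <-] := Gsurj x Xx; rewrite gK.
Qed.

Lemma exact_homeo_inv (E : normedModType R) (D : set E) (X : set M) (g : M -> E) :
  convex D -> homeo X D g -> exact_on X.
Proof.
move=> cD [[gX _ _] cg [G [cG GK]]]; apply: (exact_cell cD cG cg) => x Xx.
by rewrite GK//; split=> //; exact: gX.
Qed.

Lemma path_class_split (g : R -> M) : {within `[0, 1], continuous g} ->
  path_class g = path_class (fun t => g (2^-1 * t)) + path_class (fun t => g (2^-1 + 2^-1 * t)).
Proof.
move=> cg.
have i2 : [set` `[0, 1]] (2^-1 : R) by rewrite /= in_itv /=; apply/andP; split; lra.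
have := path_class_triangle (@convex_itv 0 1) cg i0 i2 i1.
have -> : path_class (g \o seg 0 1) = path_class g.
  by apply: eq_path_class => t _ /=; rewrite seg01.
move=> <-; congr (_ + _); apply: eq_path_class => t _ /=; congr g; rewrite segE; lra.
Qed.
End Paths.

(** * Fixed points of maps of the square *)

Section Sperner.
Local Open Scope nat_scope.
(** The three colours are [None], [Some true] and [Some false]; the marked edges
    join the last two. *)
Definition changes (a b : option bool) : bool :=
  if (a, b) is (Some x, Some y) then x (+) y else false.

Lemma changes_trichromatic a b c :
  changes a b (+) changes b c != changes a c -> forall k, k \in [:: a; b; c].
Proof. by case: a => [[]|]; case: b => [[]|]; case: c => [[]|] //= _ [[]|]. Qed.

(** Sperner's lemma in the N x N grid, each cell being cut by its rising diagonal. A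
    triangle has an odd number of marked edges only if it has the three colours.
    If there is none, the parity of the number of marked edges is the same on all
    the horizontal lines of the grid; but the top line has no marked edge, and the
    bottom line has an odd number of them. *)
Lemma sperner N (c : nat -> nat -> option bool) : 0 < N ->
  (forall i, i <= N -> c i N = None) ->
  (forall j, j < N -> c N j = Some false) ->
  (forall j, j < N -> c 0 j != Some false) ->
  (forall i, i <= N -> c i 0 != None) ->
  exists i j, [/\ i < N, j < N &
    forall k, exists a b : bool, c (i + a) (j + b) = k].
Proof.
move=> N0 top right left bot; apply: contrapT => notri.
have {notri}tri i j : i < N -> j < N ->
    changes (c i j) (c i.+1 j) (+) changes (c i.+1 j) (c i.+1 j.+1) =
    changes (c i j) (c i j.+1) (+) changes (c i j.+1) (c i.+1 j.+1).
  move=> iN jN; transitivity (changes (c i j) (c i.+1 j.+1)); last apply: esym;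
    apply: contra_notP notri => /eqP/changes_trichromatic tri; exists i, j; split=> // k;
    move: (tri k); rewrite !inE => /or3P[] /eqP ->.
  - by exists false, false; rewrite !addn0.
  - by exists true, false; rewrite addn1 addn0.
  - by exists true, true; rewrite !addn1.
  - by exists false, false; rewrite !addn0.
  - by exists false, true; rewrite addn1 addn0.
  - by exists true, true; rewrite !addn1.
pose row m j := \big[addb/false]_(i < m) changes (c i j) (c i.+1 j).
have strip j m : j < N -> m <= N ->
    row m j (+) changes (c m j) (c m j.+1) =
    changes (c 0 j) (c 0 j.+1) (+) row m j.+1.
  move=> jN; elim: m => [_|m IHm mN]; first by rewrite /row !big_ord0 addbF.
  rewrite /row !big_ord_recr -/(row m j) -/(row m j.+1) /=.
  by rewrite -addbA tri// addbA IHm 1?ltnW// !addbA.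
have left0 j : j < N -> changes (c 0 j) (c 0 j.+1) = false.
  move=> jN; have := left j jN.
  have : c 0 j.+1 != Some false.
    by move: jN; rewrite leq_eqVlt => /predU1P[->|/left//]; rewrite top.
  by case: (c 0 j) => [[]|]//; case: (c 0 j.+1) => [[]|].
have right0 j : j < N -> changes (c N j) (c N j.+1) = false.
  move=> jN; rewrite right//.
  move: (jN); rewrite leq_eqVlt => /predU1P[->|/right ->//]; by rewrite top.
have rowE j : j <= N -> row N j = row N 0.
  elim: j => // j IHj jN; rewrite -(IHj (ltnW jN)).
  by have := strip j N jN (leqnn N); rewrite left0// right0// addbF.
have rowN : row N N = false.
  by rewrite /row big1// => i _; rewrite top// ltnW.
have row0 m : m <= N -> row m 0 = changes (c 0 0) (c m 0).
  elim: m => [_|m IHm mN].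
    by rewrite /row big_ord0; case: (c 0 0) => [[]|].
  rewrite /row big_ord_recr -/(row m 0) /= IHm 1?ltnW//.
  have := bot 0 (leq0n _); have := bot m (ltnW mN); have := bot _ mN.
  by case: (c 0 0) => [[]|]//; case: (c m 0) => [[]|]//; case: (c m.+1 0) => [[]|].
have := rowE N (leqnn N); rewrite rowN row0// right//.
have := bot 0 (leq0n _); have := left 0 N0.
by case: (c 0 0) => [[]|].
Qed.
End Sperner.

Lemma compact_seq_cluster (T : topologicalType) (A : set T) (z : nat -> T) :
  compact A -> (forall n, A (z n)) ->
  exists2 x, A x & forall U, nbhs x U -> forall m, exists2 n, (m <= n)%N & U (z n).
Proof.
move=> cA zA; have FA : (z @ \oo) A by exists 0%N => // n _; exact: zA.
have [x [Ax xF]] := cA (z @ \oo) _ FA.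
exists x => // U xU m; have [|_ [[n /= mn <-] Uz]] := xF (z @` [set n | (m <= n)%N]) U _ xU.
  by exists m => // n /= mn; exists n.
by exists n.
Qed.

Section Brouwer.
Variable R : realType.

(** Points are coloured by the direction of the displacement f x - x. By Sperner's
    lemma there are arbitrarily small triangles with the three colours; at a
    cluster point of these, both coordinates of the displacement are at the same
    time nonnegative and nonpositive. *)
Lemma brouwer_square (f : R * R -> R * R) :
  {within unit_square R, continuous f} ->
  (forall x, unit_square R x -> unit_square R (f x)) ->
  exists2 x, unit_square R x & f x = x.
Proof.
move=> cf fS.
pose d1 x : R := (f x).1 - x.1; pose d2 x : R := (f x).2 - x.2.
(* the colours of the top and of the right side are forced, as the boundary
   conditions of Sperner's lemma demand *)
pose colour (x : R * R) : option bool :=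
  if x.2 == 1 then None else if x.1 == 1 then Some false else
  if (0 <= d1 x) && (0 <= d2 x) then Some true else
  if d1 x < 0 then Some false else None.
have sqP x : unit_square R x ->
    [/\ 0 <= x.1 <= 1, 0 <= x.2 <= 1, 0 <= (f x).1 <= 1 & 0 <= (f x).2 <= 1].
  move=> xS; have := fS x xS; move: xS; rewrite /unit_square /= !in_itv /=.
  by move=> [? ?] [].
have colP x : unit_square R x -> [/\ colour x = Some true -> 0 <= d1 x /\ 0 <= d2 x,
    colour x = Some false -> d1 x <= 0 & colour x = None -> d2 x <= 0].
  move=> /sqP[/andP[? ?] /andP[? ?] /andP[? ?] /andP[? ?]]; rewrite /colour.
  case: eqP => [x1|_]; first by split=> // _; rewrite /d2 subr_le0 x1.
  case: eqP => [x1|_]; first by split=> // _; rewrite /d1 subr_le0 x1.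
  case: ifPn => [/andP[? ?]//|]; rewrite negb_and -!ltNge => nd.
  case: ltP => d1x; first by split=> // _; exact: ltW.
  by split=> // _; apply: ltW; case/orP: nd => //; rewrite ltNge d1x.
have ex n : exists z : R * R, unit_square R z /\ forall k, exists x,
    [/\ unit_square R x, colour x = k & `|x - z| <= n.+1%:R^-1].
  pose pt (i j : nat) : R * R := (i%:R / n.+1%:R, j%:R / n.+1%:R).
  have ptS i j : (i <= n.+1)%N -> (j <= n.+1)%N -> unit_square R (pt i j).
    move=> iN jN; rewrite /unit_square /= !in_itv /=.
    by rewrite !divr_ge0 ?ler_pdivrMr ?mul1r ?ler_nat ?ltr0n ?ler0n ?iN ?jN.
  have N0 : (n.+1%:R : R) != 0 by rewrite pnatr_eq0.
  have pt1 i : (i%:R / n.+1%:R == 1 :> R) = (i == n.+1).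
    by rewrite -[X in _ == X](divff N0) (inj_eq (divIf N0)) eqr_nat.
  have [//|||||i [j [iN jN tri]]] := @sperner n.+1 (fun i j => colour (pt i j)).
  - by move=> i iN; rewrite /colour /= pt1 eqxx.
  - by move=> j jN; rewrite /colour /= !pt1 eqxx ltn_eqF.
  - move=> j jN; rewrite /colour /= !pt1 ltn_eqF//=.
    case: ifP => // _; case: ltP => //; rewrite ltNge.
    have /sqP[_ _ /andP[] + _ _] := ptS 0%N j (leq0n _) (ltnW jN).
    by rewrite /d1 /= mul0r subr0 => ->.
  - move=> i iN; rewrite /colour /= !pt1 /=.
    case: (i =P n.+1) => // _; case: ifPn => //; rewrite negb_and => nd.
    case: ltP => // d1x; exfalso; move: nd; rewrite d1x /=.
    have /sqP[_ _ _ /andP[]] := ptS i 0%N iN (leq0n _).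
    by rewrite /d2 /= mul0r subr0 => ->.
  exists (pt i j); split; first by apply: ptS; exact: ltnW.
  move=> k; have [a [b cab]] := tri k; exists (pt (i + a) (j + b))%N; split=> //.
    by apply: ptS; [case: a cab|case: b cab] => _; rewrite ?addn1 ?addn0// ltnW.
  have le (m : nat) (e : bool) : `|(m + e)%:R / n.+1%:R - m%:R / n.+1%:R : R| <= n.+1%:R^-1.
    by rewrite natrD mulrDl addrAC subrr add0r; case: e; rewrite ?mul0r ?mul1r ger0_norm// normr0.
  by rewrite /pt prod_normE /= ge_max !le.
have [z /all_and2[zS zP]] := choice ex.
have cS : compact (unit_square R) by apply: compact_setX; exact: segment_compact.
have [x xS xcl] := compact_seq_cluster cS zS.
have near_colour (P : R * R -> Prop) k :
    (\forall y \near within (unit_square R) (nbhs x), P y) ->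
    exists y, [/\ unit_square R y, colour y = k & P y].
  move=> /nbhs_normP[e /= e0 xe].
  have e20 : 0 < e / 2 by rewrite divr_gt0.
  have [m _ mP] := near_infty_natSinv_lt (PosNum e20).
  have [n mn zn] := xcl _ (nbhsx_ballx x _ e20) m.
  have [y [yS yk yz]] := zP n k; exists y; split=> //.
  apply: xe => //=; rewrite -[x](subrK (z n)) -addrA (le_lt_trans (ler_normD _ _))//.
  rewrite [e]splitr ltrD//; first by rewrite -ball_normE in zn.
  by rewrite distrC (le_lt_trans yz)//; exact: mP.
have PF : ProperFilter (within (unit_square R) (nbhs x)).
  by apply: within_nbhs_proper; exact: subset_closure.
have cfx : f y @[y --> within (unit_square R) (nbhs x)] --> f x.
  exact: (subspace_continuousP _ _).1 cf x xS.
have wid : y @[y --> within (unit_square R) (nbhs x)] --> x by exact: cvg_within.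
have cd1 : d1 y @[y --> within (unit_square R) (nbhs x)] --> d1 x.
  have cp : continuous (@fst R R) by move=> y; exact: cvg_fst.
  apply: cvgB; first exact: (@continuous_cvg _ _ _ _ _ f fst (f x) (cp _) cfx).
  exact: (@continuous_cvg _ _ _ _ _ id fst x (cp _) wid).
have cd2 : d2 y @[y --> within (unit_square R) (nbhs x)] --> d2 x.
  have cp : continuous (@snd R R) by move=> y; exact: cvg_snd.
  apply: cvgB; first exact: (@continuous_cvg _ _ _ _ _ f snd (f x) (cp _) cfx).
  exact: (@continuous_cvg _ _ _ _ _ id snd x (cp _) wid).
have d10 : d1 x = 0.
  apply/eqP; case: ltgtP => //.
    move=> /(cvgr_lt _ cd1)/(near_colour _ (Some true))[y [/colP[+ _ _] yk]].
    by move=> /(_ yk)[+ _]; rewrite leNgt => /negP.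
  move=> /(cvgr_gt _ cd1)/(near_colour _ (Some false))[y [/colP[_ + _] yk]].
  by move=> /(_ yk); rewrite leNgt => /negP.
have d20 : d2 x = 0.
  apply/eqP; case: ltgtP => //.
    move=> /(cvgr_lt _ cd2)/(near_colour _ (Some true))[y [/colP[+ _ _] yk]].
    by move=> /(_ yk)[_ +]; rewrite leNgt => /negP.
  move=> /(cvgr_gt _ cd2)/(near_colour _ None)[y [/colP[_ _ +] yk]].
  by move=> /(_ yk); rewrite leNgt => /negP.
exists x => //; rewrite [f x]surjective_pairing [RHS]surjective_pairing.
by rewrite (subr0_eq d10) (subr0_eq d20).
Qed.
End Brouwer.

(** * Closed walks and minimal periods *)

Section Walks.
Variables (n : nat) (A : 'M[bool]_n).

Lemma modz_succ (k : int) (q : nat) :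
  ((k + 1) %% q.+1)%Z = if (`|(k %% q.+1)%Z|.+1 == q.+1)%N then 0 else (`|(k %% q.+1)%Z|.+1)%:Z.
Proof.
have k0 : (0 <= k %% q.+1)%Z by apply: modz_ge0.
have kq : (k %% q.+1 < q.+1)%Z by apply: ltz_pmod.
rewrite -modzDml -{1}(gez0_abs k0).
move: k0 kq; case: (k %% q.+1)%Z => // m _ /=; rewrite ltz_nat => mq.
rewrite -PoszD addn1 modz_nat.
by case: eqP => [->|/eqP mN]; rewrite ?modnn// modn_small// ltn_neqAle mN.
Qed.

Lemma modz_absz (k : int) (q : nat) : (`|(k %% q.+1)%Z| < q.+1)%N.
Proof.
have k0 : (0 <= k %% q.+1)%Z by apply: modz_ge0.
by rewrite -ltz_nat gez0_abs// ltz_pmod.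
Qed.

Lemma repetition_tuple q (g : nat -> 'I_n) (k : int) :
  repetition [tuple g j | j < q.+1] k = g `|(k %% q.+1)%Z|%N.
Proof. by rewrite /repetition tnth_mktuple inordK// modz_absz. Qed.

Lemma repetition_nat q (w : q.+1.-tuple 'I_n) (k : nat) :
  (k < q.+1)%N -> repetition w k = tnth w (inord k).
Proof. by move=> kq; rewrite /repetition modz_nat absz_nat modn_small. Qed.

Lemma repetitionD q (w : q.+1.-tuple 'I_n) (k : int) :
  repetition w (k + q.+1) = repetition w k.
Proof. by rewrite /repetition modzDr. Qed.

Lemma period_tuple q (g : nat -> 'I_n) :
  (forall k, (k < q.+1)%N -> A (g k) (g k.+1)) -> g q.+1 = g 0%N ->
  period A [tuple g j | j < q.+1].
Proof.
move=> Ag g0 k; rewrite !repetition_tuple modz_succ.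
have := Ag _ (modz_absz k q); case: eqP => [e|_]; last by rewrite absz_nat.
by rewrite e g0.
Qed.

(** Simple cycles are minimal periods: a proper substring which occurs as a period
    makes w return to a symbol before its end. *)
Lemma minimal_period_tuple q (g : nat -> 'I_n) :
  (forall k, (k < q.+1)%N -> A (g k) (g k.+1)) -> g q.+1 = g 0%N ->
  (forall j k, (j < k)%N -> (k < q.+1)%N -> g j <> g k) ->
  minimal_period A [tuple g j | j < q.+1].
Proof.
move=> Ag g0 ginj; split; first exact: period_tuple.
move=> a l lq [_]; rewrite !repetition_tuple !modz_nat !absz_nat => e.
have mod_lt m : (m %% q.+1 < q.+1)%N by rewrite ltn_pmod.
have : (a + l.+1 == a + 0 %[mod q.+1])%N.
  rewrite addn0; case: ltngtP => // lt; [case: (ginj _ _ lt) => //|].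
  by case: (ginj _ _ lt) => //; rewrite -e.
by rewrite eqn_modDl mod0n modn_small.
Qed.

(** A minimal period w has distinct symbols, since the part of w between two
    occurrences of a symbol occurs in w as a period. This bounds its length by
    the number of symbols, so that minimal periods are finite in number. *)
Lemma minimal_period_size q (w : q.+1.-tuple 'I_n) : minimal_period A w -> (q < n)%N.
Proof.
move=> [Pw minw].
suff inj : injective (tnth w).
  by have := leq_card _ inj; rewrite !card_ord.
suff lt (a b : 'I_q.+1) : (a < b)%N -> tnth w a <> tnth w b.
  move=> a b wab; apply/val_inj; case: (ltngtP a b) => // ab.
    by case: (lt a b).
  by case: (lt b a).
move=> ab wab; pose l := (b - a).-1.
have al : (a + l.+1 = b)%N by rewrite /l prednK ?subn_gt0// subnKC// ltnW.
have rE (c : 'I_q.+1) : repetition w c = tnth w c.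
  by rewrite repetition_nat// inord_val.
apply: (minw a l).
  by have := ltn_ord b; rewrite /l; lia.
split; last by rewrite al !rE.
apply: (@period_tuple l (fun j => repetition w (a + j)%N)).
  by move=> k _; have := Pw (a + k)%N; rewrite -PoszD addn1 addnS.
by rewrite al addn0 !rE.
Qed.

Section Decomposition.
Variables (V : zmodType) (E : 'I_n -> 'I_n -> V) (K : V -> Prop).
Hypotheses (K0 : K 0) (KD : forall u v, K u -> K v -> K (u + v)).
Hypothesis Kmin : forall q (w : q.+1.-tuple 'I_n), minimal_period A w ->
  K (\sum_(k < q.+1) E (repetition w k) (repetition w k.+1)).

(** If a vertex is visited twice, the part g1 of the walk between the two visits
    and the remaining part g2 are shorter closed walks. *)
Lemma closed_walk_decomposition m (g : nat -> 'I_n) :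
  (forall k, (k < m)%N -> A (g k) (g k.+1)) -> g m = g 0%N ->
  K (\sum_(k < m) E (g k) (g k.+1)).
Proof.
elim/ltn_ind: m g => -[|q] IH g Ag g0; first by rewrite big_ord0.
have [[a [b [ab bq gab]]]|ninj] := pselect (exists a b, [/\ (a < b)%N, (b < q.+1)%N & g a = g b]).
  have bE : (a + (b - a) = b)%N by rewrite subnKC// ltnW.
  pose g1 k := g (a + k)%N.
  pose g2 k := if (k <= a)%N then g k else g (k + (b - a))%N.
  have K1 : K (\sum_(k < b - a) E (g1 k) (g1 k.+1)).
    apply: IH; first by rewrite (leq_ltn_trans (leq_subr _ _)).
      by move=> k kba; rewrite /g1 addnS; apply: Ag; lia.
    by rewrite /g1 bE addn0.
  have K2 : K (\sum_(k < q.+1 - (b - a)) E (g2 k) (g2 k.+1)).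
    apply: IH; first lia.
      move=> k kq; rewrite /g2; case: (ltngtP k a) => ka.
      - by apply: Ag; lia.
      - by rewrite addSn; apply: Ag; lia.
      - by rewrite ka gab addSn bE; apply: Ag; lia.
    rewrite /g2 leq0n; case: leqP => qa; last by rewrite subnK//; lia.
    have -> : (q.+1 - (b - a) = a)%N by lia.
    lia.
  suff -> : \sum_(k < q.+1) E (g k) (g k.+1) =
    \sum_(k < b - a) E (g1 k) (g1 k.+1) + \sum_(k < q.+1 - (b - a)) E (g2 k) (g2 k.+1).
    exact: KD.
  rewrite -!(big_mkord xpredT (fun k => E (_ k) (_ k.+1))).
  rewrite (@big_cat_nat _ _ _ a _ _ _ _ (leq0n a)) /=; last by lia.
  rewrite (@big_cat_nat _ _ _ b a) /=; [|exact: ltnW|exact: ltnW].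
  rewrite [X in _ = _ + X](@big_cat_nat _ _ _ a) /=; [|exact: leq0n|lia].
  have -> : \sum_(a <= i < b) E (g i) (g i.+1) =
            \sum_(0 <= i < b - a) E (g1 i) (g1 i.+1).
    rewrite -{1}[a]add0n big_addn; apply: eq_bigr => i _.
    by rewrite /g1 addnS [(a + i)%N]addnC.
  have -> : \sum_(b <= i < q.+1) E (g i) (g i.+1) =
            \sum_(a <= i < q.+1 - (b - a)) E (g2 i) (g2 i.+1).
    rewrite -{1}bE big_addn; apply: eq_big_nat => i /andP[ai _].
    rewrite /g2 [(i.+1 <= a)%N]ltnNge ai /= addSn.
    case: (ltngtP i a) ai => // -> _.
    by congr (E _ _); rewrite bE gab.
  have -> : \sum_(0 <= i < a) E (g i) (g i.+1) = \sum_(0 <= i < a) E (g2 i) (g2 i.+1).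
    by apply: eq_big_nat => i /andP[_ ia]; rewrite /g2 ia ltnW.
  by rewrite addrCA.
have ginj j k : (j < k)%N -> (k < q.+1)%N -> g j <> g k.
  by move=> jk kq gjk; apply: ninj; exists j, k.
have := Kmin (minimal_period_tuple Ag g0 ginj).
congr K; apply: eq_bigr => k _; rewrite !repetition_tuple !modz_nat !absz_nat.
rewrite (modn_small (ltn_ord k)); congr (E _ _).
have := ltn_ord k; rewrite leq_eqVlt => /predU1P[->|kq]; first by rewrite modnn g0.
by rewrite modn_small.
Qed.
End Decomposition.
End Walks.

(** * Rotations of the circle and orbit segments *)

Section Rotation.
Variable R : realType.
Implicit Types (t : R) (v w : R * R).


(** The inner product of v with its image is cos t. *)
Lemma rotation_fix t v : circle R v -> rotation t v = v -> cos t = 1.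
Proof.
case: v => a b; rewrite /circle /rotation /= => ab [e1 e2].
have -> : cos t = a * (cos t * a - sin t * b) + b * (sin t * a + cos t * b).
  transitivity (cos t * (a ^+ 2 + b ^+ 2)); first by rewrite ab mulr1.
  ring.
by rewrite e1 e2 -!expr2.
Qed.

Lemma cos2pi_lt1 t : 0 < t < 1 -> cos (2 * pi * t) != 1.
Proof.
move=> /andP[t0 t1]; rewrite -mulrA mulr_natl cos_mulr2n.
have s0 : 0 < sin (pi * t).
  apply: sin_gt0_pi; rewrite mulr_gt0 ?pi_gt0//=.
  by rewrite gtr_pMr ?pi_gt0.
rewrite cos2sin2; have : 0 < sin (pi * t) ^+ 2 by rewrite exprn_gt0.
by move: (_ ^+ 2) => s s_gt0; rewrite lt_eqF//; lra.
Qed.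

Lemma circle_angle (a b : R) : a ^+ 2 + b ^+ 2 = 1 -> exists t, cos t = a /\ sin t = b.
Proof.
move=> ab.
have a1 : -1 <= a <= 1.
  by rewrite -ler_norml -(ler_pXn2r (n := 2))// ?nnegrE// real_normK ?num_real// expr1n -ab lerDl sqr_ge0.
have sE : sin (acos a) = `|b|.
  by rewrite sin_acos// -ab addrAC subrr add0r sqrtr_sqr.
have [b0|b0] := leP 0 b.
  by exists (acos a); rewrite acosK// sE ger0_norm.
by exists (- acos a); rewrite cosN sinN acosK// sE ltr0_norm ?opprK.
Qed.

(** The cosine and the sine of the angle from v to w are the inner product and the
    determinant of v and w. *)
Lemma rotation_transitive v w : circle R v -> circle R w ->
  exists t, rotation (2 * pi * t) v = w.
Proof.
case: v w => a b [c d]; rewrite /circle /= => ab cd.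
have [|t [ct st]] := @circle_angle (a * c + b * d) (a * d - b * c).
  transitivity ((a ^+ 2 + b ^+ 2) * (c ^+ 2 + d ^+ 2)); first ring.
  by rewrite ab cd mulr1.
exists (t / (2 * pi)); rewrite mulrC divfK; last by rewrite mulf_neq0// gt_eqF// pi_gt0.
rewrite /rotation /= ct st; congr (_, _).
  by transitivity ((a ^+ 2 + b ^+ 2) * c); [ring|rewrite ab mul1r].
by transitivity ((a ^+ 2 + b ^+ 2) * d); [ring|rewrite ab mul1r].
Qed.
Lemma rotation2pi v : rotation (2 * pi) v = v.
Proof. by rewrite /rotation mulr_natl cos2pi sin2pi !mul1r !mul0r subr0 add0r -surjective_pairing. Qed.
End Rotation.

Section Flow.
Variables (R : realType) (M : topologicalType) (S : sutures M).
Variables (F L : set (chart R M)) (p : M -> R * R) (Phi : R -> M -> M).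
Hypothesis hPhi : leaf_flow S L p Phi.
Local Notation core := (core_lamination S L).
Local Notation path_class := (@path_class R M).

Lemma Phi0 q : M0 S q -> Phi 0 q = q.
Proof. by case: hPhi => _ h _ _ _ /h[]. Qed.

Lemma PhiD s t q : M0 S q -> Phi (s + t) q = Phi s (Phi t q).
Proof. by case: hPhi => _ h _ _ _ /h[_ ->]. Qed.

Lemma Phi_leaf q t : M0 S q -> leaf1 L q (Phi t q) /\ M0 S (Phi t q).
Proof.
move=> Mq; case: hPhi => _ _ h _ _.
have : [set Phi t q | t in setT] (Phi t q) by exists t.
by rewrite h// => -[].
Qed.

Lemma Phi_M0 q t : M0 S q -> M0 S (Phi t q).
Proof. by move=> /(Phi_leaf t)[]. Qed.

Lemma core_M0 : core `<=` M0 S.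
Proof.
move=> q coreq tq; have : (leaf1 L q `&` tau S) q by split=> //; exact: rst_refl.
by rewrite coreq.
Qed.

Lemma Phi_core q t : core q -> core (Phi t q).
Proof.
move=> coreq; have [qP _] := Phi_leaf t (core_M0 coreq).
rewrite /core_lamination /= -subset0 -coreq => x [Px tx]; split=> //.
exact: rst_trans qP Px.
Qed.

Lemma Phi_within (T : topologicalType) (A : set T) (u : T -> R) (b : T -> M) :
  {within A, continuous u} -> {within A, continuous b} ->
  (forall x, A x -> M0 S (b x)) ->
  {within A, continuous (fun x => Phi (u x) (b x))}.
Proof.
move=> cu cb bM; have [cPhi _ _ _ _] := hPhi.
apply: (within_comp (f := fun x => (u x, b x)) _ cPhi) => [x|x Ax]; last first.
  by split => //; exact: bM.
exact: (cvg_pair (cu x) (cb x)).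
Qed.

Definition flow_class (x : M) (T : R) := path_class (fun t => Phi (t * T) x).

Lemma flow_classD x s t : M0 S x ->
  flow_class x (s + t) = flow_class x s + flow_class (Phi s x) t.
Proof.
move=> Mx.
have cx : {within setT, continuous (fun u : R => Phi u x)}.
  apply: Phi_within => //; apply: continuous_subspaceT => u; [exact: cvg_id|exact: cvg_cst].
have cR : convex (setT : set R) by [].
have := path_class_triangle cR cx (a := 0) (b := s) (c := s + t) I I I.
move=> /esym; rewrite /flow_class => e.
transitivity (path_class ((fun u : R => Phi u x) \o seg 0 (s + t))).
  by apply: eq_path_class => u _ /=; rewrite segE; congr (Phi _ _); ring.
rewrite e; congr (_ + _); apply: eq_path_class => u _ /=; rewrite segE.
  by congr (Phi _ _); ring.
by rewrite -PhiD//; congr (Phi _ _); ring.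
Qed.

Lemma flow_class0 x : M0 S x -> flow_class x 0 = 0.
Proof.
move=> Mx; apply: (addrI (flow_class x 0)); rewrite addr0.
by rewrite -[in RHS](addr0 0) flow_classD// Phi0.
Qed.

(** The orbit segments of length u s starting at b s sweep out a square. *)
Lemma flow_homotopy (b : R -> M) (u : R -> R) :
  path_in (M0 S) b -> {within `[0, 1], continuous u} ->
  flow_class (b 0) (u 0) + path_class (fun s => Phi (u s) (b s)) =
  path_class b + flow_class (b 1) (u 1).
Proof.
move=> [cb bM] cu; pose H (st : R * R) := Phi (st.2 * u st.1) (b st.1).
have cH : {within unit_square R, continuous H}.
  apply: Phi_within.
  - move=> x; apply: cvgM; first exact: within_snd.
    by apply: (within_comp (@within_fst _ _ _) cu) => -[? ?] [].
  - by apply: (within_comp (@within_fst _ _ _) cb) => -[? ?] [].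
  - by move=> [s t] [/= s01 t01]; exact: bM.
have := square_homotopy cH; rewrite /H /= => e.
transitivity (path_class (fun t => Phi (t * u 0) (b 0)) + path_class (fun s => Phi (1 * u s) (b s))).
  by congr (_ + _); apply: eq_path_class => s _; rewrite mul1r.
rewrite e; congr (_ + _); apply: eq_path_class => s s01.
by rewrite mul0r Phi0//; exact: bM.
Qed.

End Flow.

(** * The return map *)

Section Return.
Variables (R : realType) (M : topologicalType) (S : sutures M).
Variables (F L : set (chart R M)) (p : M -> R * R) (Phi : R -> M -> M).
Variables (L0 : set M) (f : M -> M).
Hypothesis hF1 : depth_one S F p.
Hypothesis hPhi : leaf_flow S L p Phi.
Hypothesis hL0 : exists2 q, M0 S q & L0 = leaf2 F q.
Hypothesis hf : first_return Phi L0 f.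
Local Notation flow_class := (flow_class Phi).

Lemma circle_p q : M0 S q -> circle R (p q).
Proof. by case: hF1 => _ _ [_ <-] _ _ Mq; exists q. Qed.

Lemma L0E : exists2 v, circle R v & L0 = M0 S `&` p @^-1` [set v].
Proof.
case: hL0 => q Mq ->; exists (p q); first exact: circle_p.
by case: hF1 => _ _ _ _; apply.
Qed.

Lemma L0_M0 : L0 `<=` M0 S.
Proof. by case: L0E => v _ -> q []. Qed.

Lemma p_Phi q t : M0 S q -> p (Phi t q) = rotation (2 * pi * t) (p q).
Proof. by case: hPhi => _ _ _ _; apply. Qed.

Lemma Phi_reaches_L0 q : M0 S q -> exists s, L0 (Phi s q).
Proof.
case: L0E => v cv -> Mq; have [s sP] := rotation_transitive (circle_p Mq) cv.
exists s; split; first exact: (Phi_M0 hPhi).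
by rewrite /= p_Phi.
Qed.

Lemma Phi1_L0 q : L0 q -> L0 (Phi 1 q).
Proof.
case: L0E => v cv -> [Mq pq]; split; first exact: (Phi_M0 hPhi).
by rewrite /= p_Phi// mulr1 rotation2pi.
Qed.

Lemma Phi_notin_L0 q t : L0 q -> 0 < t < 1 -> ~ L0 (Phi t q).
Proof.
case: L0E => v cv -> [Mq pq] t01 [_]; rewrite /= p_Phi// pq => /(rotation_fix cv).
by apply/eqP/cos2pi_lt1.
Qed.

Lemma return_time1 q : L0 q -> f q = Phi 1 q.
Proof.
move=> Lq; have [Lfq [t [t0 fq tP]]] := hf Lq.
have t1 : t <= 1.
  by rewrite leNgt; apply/negP => t1; apply: (tP 1); rewrite ?ltr01//; exact: Phi1_L0.
move: t1; rewrite le_eqVlt => /predU1P[<-//|t1].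
by case: (@Phi_notin_L0 q t Lq); rewrite ?t0// -fq.
Qed.

Lemma iter_L0 q m : L0 q -> L0 (iter m f q).
Proof. by move=> Lq; elim: m => // m IHm; rewrite iterS; case: (hf IHm). Qed.

Lemma iter_return q m : L0 q -> iter m f q = Phi m%:R q.
Proof.
move=> Lq; have Mq := L0_M0 Lq; elim: m => [|m IHm]; first by rewrite (Phi0 hPhi).
rewrite iterS return_time1; last exact: iter_L0.
by rewrite IHm -(PhiD hPhi)// -natr1 addrC.
Qed.

(** Along an orbit, p turns with unit speed and L0 is a fibre of p. *)
Lemma L0_return_nat q t : L0 q -> 0 <= t -> L0 (Phi t q) -> exists m : nat, t = m%:R.
Proof.
move=> Lq t0 Lt; exists (Num.truncn t); apply/eqP.
have /andP[tl tr] := truncn_itv t0.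
rewrite eq_le tl andbT leNgt; apply/negP => lt.
apply: (@Phi_notin_L0 (iter (Num.truncn t) f q) (t - (Num.truncn t)%:R)).
- exact: iter_L0.
- by rewrite subr_gt0 lt/= ltrBlDl natr1.
- by rewrite iter_return// -(PhiD hPhi) ?subrK//; exact: L0_M0.
Qed.

Lemma flow_class_mul x T k : M0 S x -> Phi T x = x ->
  flow_class x (k%:R * T) = k%:R *: flow_class x T.
Proof.
move=> Mx xT.
have xk j : Phi (j%:R * T) x = x.
  elim: j => [|j IHj]; first by rewrite mul0r (Phi0 hPhi).
  by rewrite -natr1 mulrDl mul1r addrC (PhiD hPhi)// IHj.
elim: k => [|k IHk]; first by rewrite mul0r scale0r (flow_class0 hPhi).
by rewrite -natr1 mulrDl mul1r (flow_classD hPhi)// IHk xk scalerDl scale1r.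
Qed.

Lemma closed_leaf_flow_class x c : closed_leaf_class Phi x c ->
  exists T, [/\ 0 < T, Phi T x = x, forall t, 0 < t < T -> Phi t x <> x &
    h1_chain c = flow_class x T].
Proof.
by move=> [T [T0 xT minT /loop_class_path cE]]; exists T.
Qed.

Lemma loop_class_exists (g : R -> M) : {within `[0, 1], continuous g} -> g 0 = g 1 ->
  exists c, loop_class g c.
Proof.
move=> cg g01; pose s : simplex R M 1 := mkcts (path_edge_continuous cg).
have zs : mkmalgU s 1 \in cycle_pred (@boundary R M R 0).
  rewrite unfold_in; apply/eqP; rewrite -[LHS]/(lin_ext _ _) lin_extU scale1r.
  rewrite !big_ord_recr big_ord0 /= add0r expr0 expr1.
  have -> : face ord_max s = face (widen_ord (leqnSn 1) ord_max) s.
    apply/continuousEP => v /=; rewrite /mkcts /edge_coord /= !mxE.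
    have -> : unlift ord_max (ord_max : 'I_2) = None by rewrite unlift_none.
    case: unliftP => [j _|/(congr1 val)//] /=; rewrite g01; congr g.
    have [_] := set_mem (valP v); rewrite big_ord1 /= => <-.
    by congr (set_val v _ _); rewrite [j]ord1.
  by rewrite -monalgUD subrr monalgU0.
by exists (homology_class (@boundary R M R 1) (Hcycle zs)), s, (Hcycle zs).
Qed.

(** The least period of x is found among the integers, as only after an integer
    time can the orbit be back in L0. *)
Lemma closed_leaf_exists x k : L0 x -> iter k.+1 f x = x ->
  exists c, closed_leaf_class Phi x c.
Proof.
move=> Lx xk; have Mx := L0_M0 Lx.
have ex : exists m, `[< Phi m.+1%:R x = x >].
  by exists k; apply/asboolP; rewrite -iter_return.
have [m /asboolP xm min_m] := find_ex_minn ex.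
have xT : Phi m.+1%:R x = x by [].
have cg : {within `[0, 1], continuous (fun t : R => Phi (t * m.+1%:R) x)}.
  apply: (Phi_within hPhi) => //; last by apply: continuous_subspaceT => u; exact: cvg_cst.
  by apply: continuous_subspaceT => u; apply: cvgMl; exact: cvg_id.
have [|c gc] := loop_class_exists cg; first by rewrite mul0r mul1r xT (Phi0 hPhi).
exists c, m.+1%:R; split=> // t /andP[t0 tm] xt.
have [|[|j] tj] := L0_return_nat Lx (ltW t0); first by rewrite xt.
  by rewrite tj ltxx in t0.
have : (m <= j)%N by apply: min_m; apply/asboolP; rewrite -tj.
by apply/negP; rewrite -ltnNge -ltnS -(ltr_nat R) -tj.
Qed.

(** The least period of x divides k + 1, so the orbit segment runs a whole number
    of times around the closed leaf. *)
Lemma closed_leaf_multiple x k c : L0 x -> iter k.+1 f x = x ->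
  closed_leaf_class Phi x c ->
  exists2 a : R, 0 < a & a *: h1_chain c = flow_class x k.+1%:R.
Proof.
move=> Lx xk /closed_leaf_flow_class[T [T0 xT minT ->]]; have Mx := L0_M0 Lx.
have [|[|m] Tm] := L0_return_nat Lx (ltW T0); first by rewrite xT.
  by rewrite Tm ltxx in T0.
have xj j : Phi (j * m.+1)%:R x = x.
  elim: j => [|j IHj]; first by rewrite mul0n (Phi0 hPhi).
  by rewrite mulSn natrD (PhiD hPhi)// IHj -Tm.
have dvd : (m.+1 %| k.+1)%N.
  rewrite /dvdn -leqn0 leqNgt; apply/negP => r0.
  apply: (minT (k.+1 %% m.+1)%:R).
    by rewrite Tm ltr0n r0 ltr_nat ltn_pmod.
  rewrite -{1}(xj (k.+1 %/ m.+1)%N) -(PhiD hPhi)// -natrD addnC -divn_eq.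
  by rewrite -iter_return.
exists (k.+1 %/ m.+1)%:R; first by rewrite ltr0n divn_gt0// dvdn_leq.
by rewrite -flow_class_mul// Tm -natrM divnK.
Qed.

End Return.

(** * Charts, rectangles and periodic orbits *)

Lemma homeo_fixed_square (R : realType) (X : topologicalType) (Y : set X) (g : X -> X) :
  homeomorphic (unit_square R) Y -> {within Y, continuous g} ->
  (forall x, Y x -> Y (g x)) -> exists2 x, Y x & g x = x.
Proof.
move=> [h [[hY _ hsurj] ch [k [ck kh]]]] cg gY.
have hk y : Y y -> unit_square R (k y) /\ h (k y) = y.
  by move=> /hsurj[v vD <-]; rewrite kh.
have [||v vS vfix] := @brouwer_square R (k \o (g \o h)).
- by apply: within_comp ck _; [exact: within_comp ch cg hY|move=> v /hY/gY].
- by move=> v /hY/gY/hk[].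
exists (h v); first exact: hY.
by rewrite -[in RHS]vfix /= (hk _ _).2//; apply/gY/hY.
Qed.

(** Brouwer's theorem applied to the product of the map with an identity. *)
Lemma homeo_fixed_arc (R : realType) (X : topologicalType) (Y : set X) (g : X -> X) :
  homeomorphic (`[0, 1] : set R) Y -> {within Y, continuous g} ->
  (forall x, Y x -> Y (g x)) -> exists2 x, Y x & g x = x.
Proof.
move=> [h [[hY _ hsurj] ch [k [ck kh]]]] cg gY.
have hk y : Y y -> (`[0, 1] : set R)%classic (k y) /\ h (k y) = y.
  by move=> /hsurj[v vD <-]; rewrite kh.
have ckgh : {within (`[0, 1] : set R), continuous (k \o (g \o h))}.
  by apply: within_comp ck _; [exact: within_comp ch cg hY|move=> v /hY/gY].
have [||[v1 v2] [/= v1S v2S] [vfix]] := @brouwer_square R (fun v => ((k \o (g \o h)) v.1, v.2)).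
- have c1 : {within unit_square R, continuous ((k \o (g \o h)) \o fst)}.
    by apply: (within_comp (@within_fst _ _ _) ckgh) => -[? ?] [].
  by move=> x; exact: (cvg_pair (c1 x) (@within_snd _ _ _ x)).
- by move=> [a b] [/= aS bS]; split => //=; exact: (hk _ (gY _ (hY _ aS))).1.
exists (h v1); first exact: hY.
by rewrite -[in RHS]vfix /= (hk _ _).2//; apply/gY/hY.
Qed.

Lemma pigeonhole_infinite n (w : nat -> 'I_n) :
  exists i, forall K, exists2 k, (K <= k)%N & w k = i.
Proof.
apply: contrapT => /forallNP nex.
have /choice[b bP] i : exists K, forall k, (K <= k)%N -> w k <> i.
  have /existsNP[K KP] := nex i; exists K => k Kk wk; apply: KP; by exists k.
pose K := (\max_i b i)%N; apply: (bP (w K) K) => //.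
exact: (leq_bigmax (w K)).
Qed.

Lemma convex_interval (R : realType) (i : interval R) : convex [set` i].
Proof.
move=> a b t /= ai bi t01.
have H := @interval_is_interval R i.
have [ab|ba] := leP a b.
  apply: (H a b) => //; rewrite segE; apply/andP; split; nra.
apply: (H b a) => //; rewrite segE; apply/andP; split; nra.
Qed.

Lemma convex_box (R : realType) (M : topologicalType) (c : chart R M) : convex (box c).
Proof.
apply: convexX; first apply: convexX.
- by rewrite /x_range; case: ifP => _; exact: convex_interval.
- exact: convex_interval.
- by rewrite /z_range; case: (z_side c); exact: convex_interval.
Qed.

(** In the coordinates of the chart it is a product of three closed intervals. *)
Lemma flow_box_closed (R : realType) (M : topologicalType) (S : sutures M) (c : chart R M) :
  hausdorff_space M -> is_chart S c ->
  closed [set q | cdom c q /\ `|crd c q| <= 2^-1].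
Proof.
move=> hM [_ [[cB _ csurj] _ [G [cG GK]]] _].
have [a2 b2] : (-1 : R) < - 2^-1 /\ (2^-1 : R) < 1 by split; lra.
pose xr := if on_pitch c then `[(0 : R), 2^-1] else `[- (2^-1 : R), 2^-1].
pose zr : interval R := match z_side c with
  Middle => `[- 2^-1, 2^-1] | Inward => `[0, 2^-1] | Outward => `[- 2^-1, 0] end.
pose K : set (R * R * R) := [set` xr] `*` [set` `[- 2^-1, 2^-1]] `*` [set` zr].
have xrE x : [set` xr] x <-> x_range (on_pitch c) x /\ `|x| <= 2^-1.
  by rewrite /xr /x_range; case: (on_pitch c) => /=; rewrite !in_itv/= ler_norml;
    split=> [/andP[? ?]|[/andP[? ?] /andP[? ?]]];
    first [apply/andP; split; lra|split; apply/andP; split; lra].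
have zrE x : [set` zr] x <-> z_range (z_side c) x /\ `|x| <= 2^-1.
  by rewrite /zr /z_range; case: (z_side c) => /=; rewrite !in_itv/= ler_norml;
    split=> [/andP[? ?]|[/andP[? ?] /andP[? ?]]];
    first [apply/andP; split; lra|split; apply/andP; split; lra].
have KE w : K w <-> box c w /\ `|w| <= 2^-1.
  case: w => [[x y] z]; rewrite /K /box !prod_normE /= !ge_max /=; split.
    move=> [[/xrE[x1 x2] /=] + /zrE[z1 z2]]; rewrite in_itv /= -ler_norml => y1.
    rewrite x2 z2 y1; split=> //; split=> //; split=> //=.
    by rewrite in_itv /=; move: y1; rewrite ler_norml => /andP[? ?]; apply/andP; split; lra.
  move=> [[[x1 /= y1] z1] /andP[/andP[x2 y2] z2]]; split; [split|] => /=.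
  - by apply/xrE.
  - by rewrite in_itv /= -ler_norml.
  - by apply/zrE.
have cK : compact K.
  apply: compact_setX; first apply: compact_setX.
  - by rewrite /xr; case: ifP => _; exact: segment_compact.
  - exact: segment_compact.
  - by rewrite /zr; case: (z_side c); exact: segment_compact.
have -> : [set q | cdom c q /\ `|crd c q| <= 2^-1] = G @` K.
  apply/seteqP; split=> [q [cq q2]|_ [w /KE[bw w2] <-]].
    by exists (crd c q); [apply/KE; split=> //; exact: cB|rewrite GK].
  have [q cq wq] := csurj w bw.
  by rewrite -wq GK//; split=> //; rewrite wq.
apply: compact_closed => //; apply: continuous_compact => //.
by apply: continuous_subspaceW cG => w /KE[].
Qed.

Section Markov.
Variables (R : realType) (M : topologicalType) (S : sutures M).
Variables (F L : set (chart R M)) (p : M -> R * R) (Phi : R -> M -> M).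
Variables (L0 : set M) (f : M -> M).
Variables (n : nat) (r : 'I_n -> R * R -> M) (A : 'M[bool]_n).
Hypothesis hF1 : depth_one S F p.
Hypothesis hPhi : leaf_flow S L p Phi.
Hypothesis hL0 : exists2 q, M0 S q & L0 = leaf2 F q.
Hypothesis hf : first_return Phi L0 f.
Local Notation core := (core_lamination S L).
Hypothesis hA : markov_partition L0 (core `&` L0) f r A.
Local Notation flow_class := (flow_class Phi).
Local Notation path_class := (@path_class R M).
Local Notation rect i := (r i @` unit_square R).
Let L0M := L0_M0 hF1 hL0.

Lemma rect_exact i : exact_on R (rect i).
Proof.
have [/(_ i)[ri _ _ _] _ _ _ _] := hA; apply: exact_homeo ri.
by apply: convexX; exact: convex_itv.
Qed.

Lemma rect_L0 i : rect i `<=` L0.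
Proof. by have [/(_ i)[_ + _ _] _ _ _ _] := hA. Qed.

Lemma rect_cont i : {within unit_square R, continuous (r i)}.
Proof. by have [/(_ i)[[_ + _] _ _ _] _ _ _ _] := hA. Qed.

Lemma Phi_t_within (t : R) (Y : set M) : Y `<=` M0 S -> {within Y, continuous (Phi t)}.
Proof.
move=> YM; apply: (Phi_within hPhi (u := fun=> t) (b := id)) => //.
  by apply: continuous_subspaceT => u; exact: cvg_cst.
by apply: continuous_subspaceT => u; exact: cvg_id.
Qed.

(** The points y in question form the rectangle of the word ab, in which any two of
    them are joined by a path c. Flowed for unit time, c sweeps out a square whose
    first side lies in R_a and last side in R_b, where the potentials give the
    classes. *)
Lemma edge_class_exists (P : 'I_n -> M -> chain_quotient R M) a b :
  (forall i c, path_in (rect i) c -> path_class c = P i (c 1) - P i (c 0)) ->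
  A a b -> exists e, forall y, L0 y -> rect a y -> rect b (f y) ->
    P a y + flow_class y 1 = e + P b (f y).
Proof.
move=> PP Aab; pose i k := if k is 0%N then a else b.
have [_ _ wordR _ _] := hA.
have [|h hh] := wordR 1%N i; first by case.
have sq0 : unit_square R (0, 0) by split; rewrite /= in_itv /= lexx ler01.
have hW y : word_set L0 f r 1 i y <-> [/\ L0 y, rect a y & rect b (f y)].
  split=> [[Ly W]|[Ly ya yb]]; first by split=> //; [exact: (W 0%N)|exact: (W 1%N)].
  by split=> // -[|[|k]] //.
have [[hD _ hsurj] ch _] := hh.
pose y0 := h (0, 0).
exists (P a y0 + flow_class y0 1 - P b (f y0)) => y Ly ya yb.
have [v vS vy] : (h @` unit_square R) y by apply/hsurj/hW.
pose c t := h (seg (0, 0) v t).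
have segS t : t \in `[0, 1] -> unit_square R (seg (0, 0) v t).
  by move=> t01; apply: convexX (@convex_itv R 0 1) (@convex_itv R 0 1) _ _ _ sq0 vS t01.
have cc : {within `[0, 1], continuous c}.
  apply: within_comp ch segS; apply: seg_within;
    by apply: continuous_subspaceT => x; first [exact: cvg_cst|exact: cvg_id].
have cW t : t \in `[0, 1] -> [/\ L0 (c t), rect a (c t) & rect b (f (c t))].
  by move=> /segS/hD/hW.
have ca : path_in (rect a) c by split=> // t /cW[].
have cb : path_in (rect b) (fun s => Phi 1 (c s)).
  split=> [|t /cW[Lc _]]; last by rewrite -(return_time1 hF1 hPhi hL0 hf).
  apply: (within_comp cc (@Phi_t_within 1 L0 L0M)) => t /cW[] //.
have cM : path_in (M0 S) c by split=> // t /cW[/L0M].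
have := flow_homotopy hPhi cM (u := fun=> 1).
have -> : c 0 = y0 by rewrite /c seg0.
have -> : c 1 = y by rewrite /c seg1.
rewrite (PP _ _ ca) (PP _ _ cb) /c !seg0 !seg1 vy -/y0.
have Ly0 : L0 y0 by case/hW: (hD _ sq0).
rewrite -!(return_time1 hF1 hPhi hL0 hf)// => e1.
transitivity (P a y0 + (P a y - P a y0 + flow_class y 1)).
  by rewrite addrA [P a y0 + _]addrC subrK.
rewrite -e1; last by apply: continuous_subspaceT => x; exact: cvg_cst.
by rewrite !addrA addrAC.
Qed.

Lemma markov_cocycle :
  exists (P : 'I_n -> M -> chain_quotient R M) (E : 'I_n -> 'I_n -> chain_quotient R M),
  (forall i c, path_in (rect i) c -> path_class c = P i (c 1) - P i (c 0)) /\
  (forall a b, A a b -> forall y, L0 y -> rect a y -> rect b (f y) ->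
    P a y + flow_class y 1 = E a b + P b (f y)).
Proof.
have [P PP] := choice rect_exact.
have /choice[E EP] (ab : 'I_n * 'I_n) : exists e, A ab.1 ab.2 ->
    forall y, L0 y -> rect ab.1 y -> rect ab.2 (f y) ->
    P ab.1 y + flow_class y 1 = e + P ab.2 (f y).
  have [Aab|nA] := boolP (A ab.1 ab.2); last by exists 0.
  by have [e eP] := edge_class_exists PP Aab; exists e.
by exists P, (fun a b => E (a, b)); split=> // a b; exact: (EP (a, b)).
Qed.

(** The (q+1)-st iterate of f maps the itinerary set of a (q+1)-periodic itinerary
    to itself, and this set is a point, an arc or a rectangle. *)
Lemma periodic_point_exists q (w : q.+1.-tuple 'I_n) : period A w ->
  exists x, itinerary_set L0 f r (repetition w) x /\ iter q.+1 f x = x.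
Proof.
move=> Pw; set Y := itinerary_set _ _ _ _.
have YL : Y `<=` L0 by move=> x [orb [<- /(_ 0)[]]].
have iterE x : Y x -> iter q.+1 f x = Phi q.+1%:R x.
  by move=> /YL Lx; exact: (iter_return hF1 hPhi hL0 hf).
have iterY x : Y x -> Y (iter q.+1 f x).
  move=> [orb [orb0 oP]]; exists (fun k : int => orb (k + q.+1%:Z)); split.
    rewrite add0r -orb0; elim: (q.+1) => // m IHm.
    by rewrite iterS -IHm; have [_ -> _] := oP m; rewrite -PoszD addn1.
  move=> k; have [Lo fo ro] := oP (k + q.+1); split=> //.
    by rewrite fo addrAC.
  by rewrite -(repetitionD w k).
have cY : {within Y, continuous (iter q.+1 f)}.
  have := @Phi_t_within q.+1%:R Y (fun x Yx => L0M (YL x Yx)).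
  by apply: subspace_eq_continuous => x /set_mem xY; exact/esym/iterE.
suff [x Yx xP] : exists2 x, Y x & iter q.+1 f x = x by exists x.
have [_ _ _ /(_ _ Pw)[[x Yx]|arc|rectY] _] := hA.
- rewrite -/Y in Yx; exists x; first by rewrite Yx.
  by have := iterY x; rewrite Yx; apply.
- exact: homeo_fixed_arc arc cY iterY.
- exact: homeo_fixed_square rectY cY iterY.
Qed.

Lemma itinerary_nat (i : int -> 'I_n) y : itinerary_set L0 f r i y ->
  forall k : nat, rect (i k) (iter k f y).
Proof.
move=> [orb [orb0 oP]] k; have <- : orb k = iter k f y; last by case: (oP k).
elim: k => // k IHk; rewrite iterS -IHk.
by have [_ -> _] := oP k; rewrite -PoszD addn1.
Qed.

Lemma itinerary_L0 (i : int -> 'I_n) y : itinerary_set L0 f r i y -> L0 y.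
Proof. by move=> [orb [<- /(_ 0)[]]]. Qed.

Lemma Sigma_nat (i : int -> 'I_n) : Sigma A i -> forall k : nat, A (i k) (i k.+1).
Proof. by move=> Si k; have := Si k; rewrite -PoszD addn1. Qed.

Lemma period_loop_class_exists q (w : q.+1.-tuple 'I_n) : period A w ->
  exists c, period_loop_class L0 f Phi r w c.
Proof.
move=> /periodic_point_exists[x [ix xf]].
have [c cx] := closed_leaf_exists hF1 hPhi hL0 hf (itinerary_L0 ix) xf.
by exists c, x.
Qed.

Lemma core_L0_itinerary y : core y -> L0 y -> exists2 i, Sigma A i & itinerary_set L0 f r i y.
Proof.
move=> cy Ly; have [_ _ _ _ ZE] := hA.
have : (core `&` L0) y by [].
by rewrite ZE => -[i Si iy]; exists i.
Qed.

Section Cocycle.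
Variables (P : 'I_n -> M -> chain_quotient R M) (E : 'I_n -> 'I_n -> chain_quotient R M).
Hypothesis PP : forall i c, path_in (rect i) c -> path_class c = P i (c 1) - P i (c 0).
Hypothesis EP : forall a b, A a b -> forall y, L0 y -> rect a y -> rect b (f y) ->
    P a y + flow_class y 1 = E a b + P b (f y).

(** The potentials at the intermediate points cancel. *)
Lemma flow_class_walk (g : nat -> 'I_n) y m : L0 y ->
  (forall k, rect (g k) (iter k f y)) ->
  (forall k, A (g k) (g k.+1)) ->
  P (g 0%N) y + flow_class y m%:R = \sum_(k < m) E (g k) (g k.+1) + P (g m) (iter m f y).
Proof.
move=> Ly rg Ag; elim: m => [|m IHm].
  by rewrite big_ord0 add0r (flow_class0 hPhi) ?addr0//; exact: L0M.
rewrite -natr1 (flow_classD hPhi)//; last exact: L0M.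
rewrite addrA IHm big_ord_recr /= -!addrA; congr (_ + _).
rewrite -(iter_return hF1 hPhi hL0 hf)//; apply: EP => //.
- exact: (iter_L0 hf).
Qed.

Lemma period_loop_class_sum q (w : q.+1.-tuple 'I_n) c : period A w ->
  period_loop_class L0 f Phi r w c ->
  exists2 a : R, 0 < a &
    a *: h1_chain c = \sum_(k < q.+1) E (repetition w k) (repetition w k.+1).
Proof.
move=> Pw [x [ix xf cx]]; have Lx := itinerary_L0 ix.
have [a a0 ac] := closed_leaf_multiple hF1 hPhi hL0 hf Lx xf cx.
exists a => //; rewrite ac; apply: (addrI (P (repetition w 0) x)).
rewrite (@flow_class_walk (fun k : nat => repetition w k))//; last 2 first.
- exact: itinerary_nat ix.
- exact: Sigma_nat Pw.
by rewrite addrC xf; congr (P _ _ + _); have := repetitionD w 0; rewrite add0r.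
Qed.

End Cocycle.
End Markov.

(** * Homology directions lie in the cone of minimal loops *)

Lemma ball_seg (R : realType) (V : normedModType R) (x a b : V) (e t : R) :
  ball x e a -> ball x e b -> t \in `[0, 1] -> ball x e (seg a b t).
Proof.
rewrite -ball_normE /= in_itv /= => xa xb /andP[t0 t1].
have -> : x - seg a b t = (1 - t) *: (x - a) + t *: (x - b).
  rewrite /seg !scalerBr opprD addrACA -scalerDl subrK scale1r.
  by [].
rewrite (le_lt_trans (ler_normD _ _))// !normrZ !ger0_norm ?subr_ge0//.
move: `|x - a| `|x - b| xa xb => u v ue ve.
have [uv|/ltW vu] := leP u v; nra.
Qed.

Lemma closed_walk_in_finite_cone (R : realType) (V W : lmodType R)
    (iota : {linear V -> W}) (s : seq V) (n : nat) (A : 'M[bool]_n) (E : 'I_n -> 'I_n -> W) :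
  (forall q (w : q.+1.-tuple 'I_n), minimal_period A w ->
    exists a c, [/\ 0 < a, c \in s &
      a *: iota c = \sum_(k < q.+1) E (repetition w k) (repetition w k.+1)]) ->
  forall m (g : nat -> 'I_n), (forall k, A (g k) (g k.+1)) -> g m = g 0%N ->
  exists2 c, cone_of [set` s] c & iota c = \sum_(k < m) E (g k) (g k.+1).
Proof.
move=> sE m g Ag g0.
apply: (@closed_walk_decomposition n A W E
  (fun v => exists2 c, cone_of [set` s] c & iota c = v)) => //.
- by exists 0; [exact: cone_of0|rewrite linear0].
- by move=> _ _ [c cs <-] [d ds <-]; exists (c + d); [exact: cone_ofD|rewrite linearD].
- move=> q w /sE[a [c [a0 cs ac]]]; exists (a *: c); last by rewrite linearZ.
  by apply: cone_ofZ; [exact: ltW|exact: cone_of_gen].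
Qed.

Lemma linear_injD (R : realType) (V W : lmodType R) (iota : {linear V -> W}) (x y c : V) :
  injective iota -> iota x = iota y + iota c -> x = y + c.
Proof. by move=> inj e; apply: inj; rewrite linearD. Qed.

Lemma linear_inj_cone (R : realType) (V W : lmodType R) (iota : {linear V -> W})
    (s : seq V) (a : R) (c d : V) : injective iota -> 0 < a ->
  iota d = a *: iota c -> cone_of [set` s] d -> cone_of [set` s] c.
Proof.
move=> inj a0; rewrite -linearZ => /inj -> cd.
rewrite -[c]scale1r -(mulVf (lt0r_neq0 a0)) -scalerA.
by apply: cone_ofZ cd; rewrite invr_ge0 ltW.
Qed.

Lemma sum_ord_cat (V : nmodType) (F : nat -> V) m1 m2 : (m1 <= m2)%N ->
  \sum_(l < m2) F l = \sum_(l < m1) F l + \sum_(l < m2 - m1) F (m1 + l)%N.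
Proof. by move=> m12; rewrite -[in LHS](subnKC m12) big_split_ord. Qed.

Section Cone.
Variables (R : realType) (M : topologicalType) (S : sutures M).
Variables (F L : set (chart R M)) (p : M -> R * R) (Phi : R -> M -> M).
Variables (L0 : set M) (f : M -> M).
Variables (n : nat) (r : 'I_n -> R * R -> M) (A : 'M[bool]_n).
Hypothesis hM : hausdorff_space M.
Hypothesis hF1 : depth_one S F p.
Hypothesis hPhi : leaf_flow S L p Phi.
Hypothesis hL0 : exists2 q, M0 S q & L0 = leaf2 F q.
Hypothesis hf : first_return Phi L0 f.
Local Notation core := (core_lamination S L).
Hypothesis hA : markov_partition L0 (core `&` L0) f r A.
Local Notation flow_class := (flow_class Phi).
Local Notation path_class := (@path_class R M).
Local Notation rect i := (r i @` unit_square R).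
Let L0M := L0_M0 hF1 hL0.
Variables (P : 'I_n -> M -> chain_quotient R M) (E : 'I_n -> 'I_n -> chain_quotient R M).
Hypothesis PP : forall i c, path_in (rect i) c -> path_class c = P i (c 1) - P i (c 0).
Hypothesis EP : forall a b, A a b -> forall y, L0 y -> rect a y -> rect b (f y) ->
    P a y + flow_class y 1 = E a b + P b (f y).
Variable s : seq (H1 R M).
Hypothesis sE : forall q (w : q.+1.-tuple 'I_n), minimal_period A w ->
  exists a c, [/\ 0 < a, c \in s &
    a *: h1_chain c = \sum_(k < q.+1) E (repetition w k) (repetition w k.+1)].

Lemma closed_walk_in_cone m (g : nat -> 'I_n) :
  (forall k, A (g k) (g k.+1)) -> g m = g 0%N ->
  exists2 c, cone_of [set` s] c & h1_chain c = \sum_(k < m) E (g k) (g k.+1).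
Proof. exact: (closed_walk_in_finite_cone sE). Qed.

(** The itinerary of a periodic point y need not be periodic, since y may lie on
    edges of several rectangles. But some symbol occurs at two times which are
    multiples of the period, and the walk between these times is closed. *)
Lemma closed_leaf_in_cone x c : core x -> closed_leaf_class Phi x c -> cone_of [set` s] c.
Proof.
move=> cx /closed_leaf_flow_class[T [T0 xT _ cE]].
have Mx := core_M0 cx.
have [t Ly] := Phi_reaches_L0 hF1 hPhi hL0 Mx; set y := Phi t x in Ly.
have cy : core y := Phi_core hPhi t cx.
have yT : Phi T y = y by rewrite /y -(PhiD hPhi)// addrC (PhiD hPhi)// xT.
have {}cE : h1_chain c = flow_class y T.
  rewrite cE; apply: (addrI (flow_class x t)).
  by rewrite -(flow_classD hPhi)// [(t + T)%R]addrC (flow_classD hPhi)// xT addrC.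
have [|[|m] Tm] := L0_return_nat hF1 hPhi hL0 hf Ly (ltW T0); first by rewrite yT.
  by rewrite Tm ltxx in T0.
have [i Si iy] := core_L0_itinerary hA cy Ly.
have iter_y j : iter (j * m.+1) f y = y.
  elim: j => // j IHj; rewrite mulSn iterD IHj.
  by rewrite (iter_return hF1 hPhi hL0 hf)// -Tm.
have [a aP] := pigeonhole_infinite (fun j => i (j * m.+1)%N).
have [j _ ja] := aP 0%N; have [k jk ka] := aP j.+1.
pose g l := i (j * m.+1 + l)%N.
have kj0 : (0 < k - j)%N by rewrite subn_gt0.
have gk : g ((k - j) * m.+1)%N = g 0%N.
  by rewrite /g addn0 ja -mulnDl subnKC ?ka// ltnW.
have Ag l : A (g l) (g l.+1) by rewrite /g addnS; exact: Sigma_nat Si _.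
have rg l : rect (g l) (iter l f y).
  have := itinerary_nat iy (j * m.+1 + l)%N.
  by rewrite addnC iterD iter_y addnC.
have [d ds dE] := closed_walk_in_cone Ag gk.
have := flow_class_walk hF1 hPhi hL0 hf EP ((k - j) * m.+1)%N Ly rg Ag.
rewrite gk iter_y addrC => /addIr; rewrite -dE natrM -Tm.
rewrite (flow_class_mul hPhi)//; last exact: core_M0 cy.
rewrite -cE => cd; apply: (linear_inj_cone (@h1_chain_inj R M) _ (esym cd) ds).
by rewrite ltr0n.
Qed.

Lemma close_up_class x T (a : R -> M) : M0 S x -> {within `[0, 1], continuous a} ->
  a 0 = Phi T x -> path_class (close_up Phi x T a) = flow_class x T + path_class a.
Proof.
move=> Mx ca a0.
have h2 : (2 : R) * 2^-1 = 1 by rewrite mulfV.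
have c1 : {within `[0, 2^-1], continuous (close_up Phi x T a)}.
  have : {within `[0, 2^-1], continuous (fun t => Phi (2 * t * T) x)}.
    apply: (Phi_within hPhi (b := fun=> x)) => //; apply: continuous_subspaceT => t.
      by apply: cvgMl; apply: cvgMr; exact: cvg_id.
    exact: cvg_cst.
  apply: subspace_eq_continuous => t /set_mem /=; rewrite in_itv /= => /andP[_ t2].
  by rewrite /close_up /from_subspace t2.
have c2 : {within `[2^-1, 1], continuous (close_up Phi x T a)}.
  have : {within `[2^-1, 1], continuous (a \o (fun t => 2 * t - 1))}.
    apply: (within_comp _ ca).
      apply: continuous_subspaceT => t; apply: cvgB; last exact: cvg_cst.
      by apply: cvgMr; exact: cvg_id.
    by move=> t; rewrite /= !in_itv /= => /andP[? ?]; apply/andP; split; lra.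
  apply: subspace_eq_continuous => t /set_mem /=; rewrite in_itv /= => /andP[t2 _].
  rewrite /close_up /from_subspace /=; case: ifP => // t2'.
  have -> : t = 2^-1 by apply/eqP; rewrite eq_le t2' t2.
  by rewrite h2 subrr a0 mul1r.
have cc : {within `[0, 1], continuous (close_up Phi x T a)}.
  have -> : [set` `[(0 : R), 1]] = [set` `[0, 2^-1]] `|` [set` `[2^-1, 1]].
    apply/seteqP; split => t /=; rewrite !in_itv /=.
      by move=> /andP[-> ->]; have [?|/ltW ?] := leP t 2^-1; [left|rewrite andbT; right].
    by case=> /andP[? ?]; apply/andP; split; lra.
  by apply: withinU_continuous => //; exact: itv_closed.
rewrite path_class_split//; congr (_ + _); apply: eq_path_class => t.
  rewrite in_itv /= => /andP[t0 t1]; rewrite /close_up ifT; last lra.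
  by rewrite mulrA h2 mul1r.
rewrite in_itv /= => /andP[t0 t1]; rewrite /close_up; case: ifP => t2.
  have -> : t = 0 by lra.
  by rewrite mulr0 addr0 h2 mul1r a0.
by congr a; lra.
Qed.

(** Up to a constant, the expression is the class of a path which goes in R_i from a
    base point to another point, follows the flow into O and goes in O to a base
    point. For parameters in a small ball, the segment between them gives a homotopy. The
    flowed rectangle and O may meet in infinitely many components, so that this is only a
    local statement. *)
Lemma tube_locally_constant i (Q : M -> chain_quotient R M) (O : set M) (w : R * R * R) :
  open O -> (forall c, path_in O c -> path_class c = Q (c 1) - Q (c 0)) ->
  (unit_square R `*` `[0, 1]) w -> O (Phi w.2 (r i w.1)) ->
  exists2 U, nbhs w U & forall w1 w2,
    U w1 -> U w2 -> (unit_square R `*` `[0, 1]) w1 -> (unit_square R `*` `[0, 1]) w2 ->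
    P i (r i w1.1) + flow_class (r i w1.1) w1.2 - Q (Phi w1.2 (r i w1.1)) =
    P i (r i w2.1) + flow_class (r i w2.1) w2.2 - Q (Phi w2.2 (r i w2.1)).
Proof.
move=> oO QP wD Ow; pose D : set (R * R * R) := unit_square R `*` `[0, 1].
have cD : convex D by do 2?[apply: convexX]; exact: convex_itv.
have riM v : unit_square R v -> M0 S (r i v).
  by move=> vS; apply/L0M/(rect_L0 hA (i := i)); exists v.
have cr : {within D, continuous (fun v => r i v.1)}.
  by apply: (within_comp (@within_fst _ _ _) (rect_cont hA (i := i))) => -[? ?] [].
have cPhi : {within D, continuous (fun v => Phi v.2 (r i v.1))}.
  apply: (Phi_within hPhi) => //; first exact: within_snd.
  by move=> [? ?] [/riM].
have := (subspace_continuousP _ _).1 cPhi w wD O (open_nbhs_nbhs (conj oO Ow)).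
move=> /nbhs_ballP[e /= e0 wO]; exists (ball w e); first exact: nbhsx_ballx.
move=> w1 w2 w1e w2e w1D w2D; pose c t := seg w1 w2 t.
have cc : {within `[0, 1], continuous c}.
  apply: seg_within; by apply: continuous_subspaceT => x; first [exact: cvg_cst|exact: cvg_id].
have cDt t : t \in `[0, 1] -> D (c t) by move=> t01; apply: cD.
have cO : path_in O (fun t => Phi (c t).2 (r i (c t).1)).
  split=> [|t t01]; first exact: within_comp cc cPhi cDt.
  by apply: wO; [exact: ball_seg|exact: cDt].
have crect : path_in (rect i) (fun t => r i (c t).1).
  split=> [|t t01]; first exact: within_comp cc cr cDt.
  by exists (c t).1 => //; case: (cDt t t01).
have cM : path_in (M0 S) (fun t => r i (c t).1).
  by split=> [|t t01]; [case: crect|apply: riM; case: (cDt t t01)].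
have := flow_homotopy hPhi cM (u := fun t => (c t).2).
rewrite (QP _ cO) (PP crect) /c !seg0 !seg1 => e1.
have {}e1 := e1 (within_comp cc (@within_snd _ _ D) cDt).
have -> : P i (r i w1.1) + flow_class (r i w1.1) w1.2 - Q (Phi w1.2 (r i w1.1)) =
    P i (r i w1.1) + (flow_class (r i w1.1) w1.2 +
      (Q (Phi w2.2 (r i w2.1)) - Q (Phi w1.2 (r i w1.1)))) - Q (Phi w2.2 (r i w2.1)).
  by rewrite -!addrA; congr (_ + (_ + _)); rewrite addrC subrK.
by rewrite e1 addrA [P i (r i w1.1) + _]addrC subrK.
Qed.

(** A functional which is nonnegative on the cone is bounded below by its value at
    g0 on infinitely many g k, and division by tk k makes this bound tend to 0. *)
Lemma H1_cvg_in_cone (tk : nat -> R) (g : nat -> H1 R M) (l : H1 R M) :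
  (forall k, 0 < tk k) -> tk @ \oo --> +oo ->
  H1_cvg (fun k => (tk k)^-1 *: g k) l ->
  (exists g0, forall K, exists2 k, (K <= k)%N & exists2 c, cone_of [set` s] c & g k = g0 + c) ->
  cone_of [set` s] l.
Proof.
move=> tk0 tkoo gl [g0 gP]; apply: contrapT => /farkas[phi [phis phil]].
have phil2 : phi l / 2 < 0 by rewrite pmulr_llt0 ?invr_gt0.
have phil3 : phi l < phi l / 2 by move: (phi l) phil => x; lra.
have lt1 : \forall k \near \oo, phi ((tk k)^-1 *: g k) < phi l / 2.
  have glR : (fun k => phi ((tk k)^-1 *: g k) : R) @ \oo --> (phi l : R) := gl phi.
  exact: cvgr_lt glR _ phil3.
have lt2 : \forall k \near \oo, phi g0 / (phi l / 2) < tk k.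
  by move/cvgryPgt : tkoo; exact.
have [K _ KP] : \forall k \near \oo,
   phi ((tk k)^-1 *: g k) < phi l / 2 /\ phi g0 / (phi l / 2) < tk k.
  by near=> k; split; near: k.
have [k Kk [c cs gk]] := gP K.
have [k1 k2] := KP k Kk.
have : phi (g k) < tk k * (phi l / 2).
  by rewrite -ltr_pdivrMl//; move: k1; rewrite linearZ.
have : tk k * (phi l / 2) < phi g0.
  by rewrite -ltr_ndivrMr.
have := cone_of_ge0 phis cs.
rewrite gk linearD /=; move: (phi c) (phi g0) (_ * _) => x y z; lra.
Unshelve. all: by end_near. Qed.

(** The k-th loop is the sum of a class which does not depend on k, of the weight of
    the walk of length m k, and of a correction V at the end of this walk. By
    compactness there is a subsequence on which the walk ends at a fixed symbol
    i0 and the parameters of its endpoint and of the remaining time converge in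
    R_i0 x [0, 1]. Near the limit V is constant, and two loops of the subsequence
    differ by the closed walk between their ends. *)
Lemma asymptotic_cycle_in_cone x (tk : nat -> R) (B : set M) (a : nat -> R -> M)
  (g : nat -> H1 R M) (l : H1 R M) :
  core x -> flow_box S L B ->
  (forall k, 0 < tk k) -> {homo tk : k l / (k < l)%N >-> k < l} -> tk @ \oo --> +oo ->
  (forall k, B (Phi (tk k) x)) ->
  (forall k, [/\ {within `[0, 1], continuous (a k)}, a k @` `[0, 1] `<=` B,
                 a k 0 = Phi (tk k) x & a k 1 = x]) ->
  (forall k, loop_class (close_up Phi x (tk k) (a k)) (g k)) ->
  H1_cvg (fun k => (tk k)^-1 *: g k) l -> cone_of [set` s] l.
Proof.
move=> cx [c0 [c0S _ BE]] tk0 tkinc tkoo tkB aP gP gl.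
apply: (H1_cvg_in_cone tk0 tkoo gl).
have Mx := core_M0 cx.
have [t0 Ly] := Phi_reaches_L0 hF1 hPhi hL0 Mx; set y := Phi t0 x in Ly.
have cy : core y := Phi_core hPhi t0 cx.
have [i Si iy] := core_L0_itinerary hA cy Ly.
have [_ chO _] := c0S.
have [Q QP] : exact_on R (cdom c0) by apply: exact_homeo_inv chO; exact: convex_box.
have [k0 _ k0P] : \forall k \near \oo, t0 <= tk k by move/cvgryPge : tkoo; exact.
pose m k := Num.truncn (tk k - t0).
pose u k := tk k - t0 - (m k)%:R.
have uP k : (k0 <= k)%N -> u k \in `[0, 1].
  move=> kk; have := k0P k kk; rewrite /= -subr_ge0 => /truncn_itv.
  rewrite -/(m k) -natr1 in_itv /= /u => /andP[? ?]; apply/andP; split; lra.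
have mle j k : (j <= k)%N -> (m j <= m k)%N.
  rewrite leq_eqVlt => /predU1P[-> //|jk]; apply: le_truncn.
  by rewrite lerB// ltW// tkinc.
have /choice[v vP] (k : nat) : exists v, unit_square R v /\ r (i k) v = iter k f y.
  by have [v vS vy] := itinerary_nat iy k; exists v.
have zE k : Phi (tk k) x = Phi (u k) (r (i (m k)) (v (m k))).
  rewrite (vP _).2 (iter_return hF1 hPhi hL0 hf)// /y -!(PhiD hPhi)//; last exact: (Phi_M0 hPhi).
  by congr (Phi _ _); rewrite /u; ring.
pose V (k : 'I_n) v u := P k (r k v) + flow_class (r k v) u - Q (Phi u (r k v)).
have gE k : h1_chain (g k) = flow_class x t0 - P (i 0) y + Q x +
    \sum_(j < m k) E (i j) (i j.+1) + V (i (m k)) (v (m k)) (u k).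
  rewrite /V.
  have [ca aB a0 a1] := aP k.
  rewrite (loop_class_path (gP k)) close_up_class//.
  rewrite (QP (a k)); last first.
    split=> // t t01; have : B (a k t) by apply: aB; exists t.
    by rewrite BE => -[].
  rewrite a0 a1 -zE (vP _).2.
  have -> : tk k = t0 + ((m k)%:R + u k) by rewrite /u; ring.
  rewrite (flow_classD hPhi)// (flow_classD hPhi); last exact: core_M0 cy.
  rewrite -/y -(iter_return hF1 hPhi hL0 hf)//.
  have := flow_class_walk hF1 hPhi hL0 hf EP (m k) Ly (itinerary_nat iy) (Sigma_nat Si).
  move=> /(canRL (addKr _)) ->; rewrite !addrA.
  by rewrite [LHS](ACl (1*2*6*3*4*5*7))/=.
have [i0 i0P] := pigeonhole_infinite (fun k => i (m k)).
have /choice[kk kkP] (j : nat) : exists k, (maxn j k0 <= k)%N /\ i (m k) = i0.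
  by have [k kj ik] := i0P (maxn j k0); exists k.
have kkj j : (j <= kk j)%N by have [+ _] := kkP j; rewrite geq_max => /andP[].
have kk0 j : (k0 <= kk j)%N by have [+ _] := kkP j; rewrite geq_max => /andP[].
pose D : set (R * R * R) := unit_square R `*` `[0, 1].
have cD : compact D.
  by do 2?[apply: compact_setX]; exact: segment_compact.
pose w j := (v (m (kk j)), u (kk j)).
have wD j : D (w j) by split; [exact: (vP _).1|exact: uP].
have [w0 w0D w0cl] := compact_seq_cluster cD wD.
have zw j : Phi (tk (kk j)) x = Phi (w j).2 (r i0 (w j).1).
  by rewrite zE (kkP j).2.
have cPhi : {within D, continuous (fun v => Phi v.2 (r i0 v.1))}.
  apply: (Phi_within hPhi); first exact: within_snd.
    by apply: (within_comp (@within_fst _ _ _) (rect_cont hA (i := i0))) => -[? ?] [].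
  by move=> [a1 b1] [/= a1S _]; apply/L0M/(rect_L0 hA (i := i0)); exists a1.
have cB : closed B by rewrite BE; exact: flow_box_closed hM c0S.
(* B is closed, so the limit is in the chart domain, on which Q is a potential *)
have Bw0 : B (Phi w0.2 (r i0 w0.1)).
  apply: contrapT => nB.
  have oB : open_nbhs (Phi w0.2 (r i0 w0.1)) (~` B).
    by split => //; exact: closed_openC.
  have := (subspace_continuousP _ _).1 cPhi w0 w0D _ (open_nbhs_nbhs oB).
  move=> /w0cl/(_ 0%N)[j _ /(_ (wD j))]; apply.
  by have := tkB (kk j); rewrite zw.
have [||U wU UP] := @tube_locally_constant i0 Q (cdom c0) w0 _ QP w0D.
- by case: c0S.
- by move: Bw0; rewrite BE => -[].
have [j0 _ Uj0] := w0cl U wU 0%N.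
exists (g (kk j0)) => K.
have [j jK Uj] := w0cl U wU (maxn K (kk j0)).
move: jK; rewrite geq_max => /andP[Kj j0j].
exists (kk j); first exact: leq_trans (kkj j).
have mj : (m (kk j0) <= m (kk j))%N.
  by apply: mle; exact: leq_trans (kkj j).
pose gg d := i (m (kk j0) + d)%N.
have Ag d : A (gg d) (gg d.+1) by rewrite /gg addnS; exact: Sigma_nat Si _.
have gg0 : gg (m (kk j) - m (kk j0))%N = gg 0%N.
  by rewrite /gg subnKC// addn0 (kkP j).2 (kkP j0).2.
have [c cs cE] := closed_walk_in_cone Ag gg0.
exists c; first exact: cs.
apply: (linear_injD (@h1_chain_inj R M)).
have := gE (kk j); have := gE (kk j0); move: cE => /= -> -> ->.
have VE : V (i (m (kk j))) (v (m (kk j))) (u (kk j)) =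
          V (i (m (kk j0))) (v (m (kk j0))) (u (kk j0)).
  by rewrite (kkP j).2 (kkP j0).2; exact: UP _ _ Uj Uj0 (wD j) (wD j0).
rewrite VE {VE}; move: (V _ _ _) (_ + Q x) => v1 v2.
have -> : \sum_(l < m (kk j)) E (i l) (i l.+1) =
    \sum_(l < m (kk j0)) E (i l) (i l.+1) +
    \sum_(l < m (kk j) - m (kk j0)) E (gg l) (gg l.+1).
  rewrite (sum_ord_cat (fun l => E (i l) (i l.+1)) mj); congr (_ + _).
  by apply: eq_bigr => d _; rewrite /gg addnS.
by rewrite addrA [LHS]addrAC.
Qed.

End Cone.

(** * The cone and its dual *)

Definition minimal_values (n : nat) (A : 'M[bool]_n) (V : eqType)
    (h : forall q, q.+1.-tuple 'I_n -> V) : seq V :=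
  [seq h q w | q <- iota 0 n,
               w <- [seq w <- enum {: q.+1.-tuple 'I_n} | `[< minimal_period A w >]]].

Lemma minimal_valuesP (n : nat) (A : 'M[bool]_n) (V : eqType)
    (h : forall q, q.+1.-tuple 'I_n -> V) :
  [set` minimal_values A h] =
  [set c | exists q (w : q.+1.-tuple 'I_n), minimal_period A w /\ c = h q w].
Proof.
apply/seteqP; split=> c /=.
  move=> /allpairsPdep[q [w [_ + ->]]]; rewrite mem_filter => /andP[/asboolP mw _].
  by exists q, w.
move=> [q [w [mw ->]]]; apply/allpairsPdep; exists q, w; split=> //.
  by rewrite mem_iota (minimal_period_size mw).
by rewrite mem_filter mem_enum andbT; apply/asboolP.
Qed.

Section Main.
Variables (R : realType) (M : topologicalType) (S : sutures M).
Variables (F L : set (chart R M)) (p : M -> R * R) (Phi : R -> M -> M).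
Variables (L0 : set M) (f : M -> M).
Variables (n : nat) (r : 'I_n -> R * R -> M) (A : 'M[bool]_n).
Hypothesis hM : hausdorff_space M.
Hypothesis hF1 : depth_one S F p.
Hypothesis hPhi : leaf_flow S L p Phi.
Hypothesis hL0 : exists2 q, M0 S q & L0 = leaf2 F q.
Hypothesis hf : first_return Phi L0 f.
Hypothesis hA : markov_partition L0 (core_lamination S L `&` L0) f r A.
Variable h : forall q, q.+1.-tuple 'I_n -> H1 R M.
Hypothesis hP : forall q (w : q.+1.-tuple 'I_n), minimal_period A w ->
  period_loop_class L0 f Phi r w (h w).

(** Each generator is a homology direction by definition; the other inclusion
    combines the two kinds of homology directions with the closedness of a finitely
    generated cone. *)
Lemma homology_coneE : homology_cone S L Phi (core_lamination S L) =
  cone_of [set` minimal_values A h].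
Proof.
have [P [E [PP EP]]] := markov_cocycle hF1 hPhi hL0 hf hA.
set s := minimal_values A h.
have sE q (w : q.+1.-tuple 'I_n) : minimal_period A w -> exists a c, [/\ 0 < a, c \in s &
    a *: h1_chain c = \sum_(k < q.+1) E (repetition w k) (repetition w k.+1)].
  move=> mw; have [Pw _] := mw.
  have [a a0 ac] := period_loop_class_sum hF1 hPhi hL0 hf EP Pw (hP mw).
  have hs : [set` s] (h w) by rewrite /s minimal_valuesP; exists q, w.
  by exists a, (h w).
apply/seteqP; split=> c.
  move=> cl; apply: H1_closure_finite_cone => m phi e e0.
  have [d dC de] := cl m phi e e0; exists d => //.
  apply: cone_of_min dC => {d de}d [[x cx dx]|].
    exact: (closed_leaf_in_cone hF1 hPhi hL0 hf hA EP sE cx dx).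
  move=> [x [tk [B [a [g [[cx fB] [tk0 tki tkoo] [_ tkB] aP [gP gl]]]]]]].
  exact: (asymptotic_cycle_in_cone hM hF1 hPhi hL0 hf hA PP EP sE cx fB tk0 tki tkoo tkB aP gP gl).
move=> cs m phi e e0; exists c; last by move=> i; rewrite subrr normr0.
apply: cone_of_min cs => {}c; rewrite minimal_valuesP => -[q [w [mw ->]]].
apply: cone_of_gen; left; have [x [ix xf cx]] := hP mw; exists x => //.
have [_ _ _ _ ZE] := hA; have [] // : (core_lamination S L `&` L0) x.
by rewrite ZE; exists (repetition w) => //; case: mw.
Qed.
End Main.

Lemma dual_cone_of (R : realType) (M : topologicalType) (G : set (H1 R M)) :
  dual_cone (cone_of G) = [set alpha | forall c, G c -> 0 <= kronecker alpha c].
Proof.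
apply/seteqP; split=> alpha /= aG c; first by move=> Gc; apply/aG/cone_of_gen.
pose aL := GRing.isLinear.Build R (H1 R M) R^o *:%R (kronecker alpha) (kronecker_linearr alpha).
pose aH : {linear H1 R M -> R^o} := HB.pack (kronecker alpha) aL.
exact: (cone_of_ge0 (phi := aH) aG).
Qed.

Lemma polyhedral_dual_cone (R : realType) (M : topologicalType) (s : seq (H1 R M)) :
  polyhedral (dual_cone (cone_of [set` s])).
Proof.
have ex c : exists phi : {linear coH1 R M -> R^o}, forall alpha, phi alpha = kronecker alpha c.
  pose aL := GRing.isLinear.Build R (coH1 R M) R^o *:%R _ (kronecker_linearl c).
  pose aH : {linear coH1 R M -> R^o} := HB.pack (fun alpha : coH1 R M => kronecker alpha c) aL.
  by exists aH.
have [phi phiE] := choice ex.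
exists (size s), (fun i => phi (tnth (in_tuple s) i)).
rewrite dual_cone_of; apply/seteqP; split=> alpha /= aP.
  by move=> i; rewrite phiE; apply: aP; exact: mem_tnth.
move=> c cs; have /tnthP[i ->] : c \in in_tuple s by [].
by rewrite -phiE.
Qed.

Unset Implicit Arguments.

Theorem theorem4p14 (R : realType) (M : topologicalType) (S : sutures M)
  (F L : set (chart R M)) (p : M -> R * R) (Phi : R -> M -> M)
  (L0 : set M) (f : M -> M)
  (n : nat) (r : 'I_n -> R * R -> M) (A : 'M[bool]_n)
  (hM : standing_hypotheses R S)
  (hF : foliation2 S F) (hFtaut : taut S F) (hF1 : depth_one S F p)
  (hL : foliation1 S L) (hFL : transverse S F L) (hLann : product_on_annuli S L)
  (hPhi : leaf_flow S L p Phi)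
  (hL0 : exists2 q, M0 S q & L0 = leaf2 F q)
  (hf : first_return Phi L0 f)
  (hA : markov_partition L0 (core_lamination S L `&` L0) f r A) :
  let C := homology_cone S L Phi (core_lamination S L) in
  let D := dual_cone C in
  [/\ exists (m : nat) (c : 'I_m -> H1 R M),
        (forall i, minimal_loop_class L0 f Phi r A (c i)) /\
        C = cone_of (range c),
      polyhedral D,
      forall q (w : q.+1.-tuple 'I_n), minimal_period A w ->
        exists c, period_loop_class L0 f Phi r w c &
      forall h : (forall q, q.+1.-tuple 'I_n -> H1 R M),
        (forall q (w : q.+1.-tuple 'I_n), minimal_period A w ->
           period_loop_class L0 f Phi r w (h q w)) ->
        C = cone_of [set c | exists q (w : q.+1.-tuple 'I_n),
                               minimal_period A w /\ c = h q w] /\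
        D = [set alpha | forall q (w : q.+1.-tuple 'I_n),
                           minimal_period A w -> 0 <= kronecker alpha (h q w)]].
Proof.
move=> C D.
have hMh : hausdorff_space M by case: hM => -[[]].
have loop q (w : q.+1.-tuple 'I_n) : minimal_period A w ->
    exists c, period_loop_class L0 f Phi r w c.
  by move=> [Pw _]; exact: (period_loop_class_exists hF1 hPhi hL0 hf hA Pw).
have CE h (hP : forall q (w : q.+1.-tuple 'I_n), minimal_period A w ->
    period_loop_class L0 f Phi r w (h q w)) :=
  homology_coneE hMh hF1 hPhi hL0 hf hA hP.
have /choice[h hP] (qw : {q & q.+1.-tuple 'I_n}) : exists c,
    minimal_period A (projT2 qw) -> period_loop_class L0 f Phi r (projT2 qw) c.
  have [/loop[c cP]|nm] := pselect (minimal_period A (projT2 qw)); first by exists c.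
  by exists 0.
have {}hP q (w : q.+1.-tuple 'I_n) : minimal_period A w ->
    period_loop_class L0 f Phi r w (h (existT _ q w)) := hP (existT _ q w).
have Ch := CE (fun q w => h (existT _ q w)) hP.
split => //.
- set s := minimal_values _ _ in Ch; exists (size s), (tnth (in_tuple s)); split=> [i|].
    have : [set` s] (tnth (in_tuple s) i) by exact: mem_tnth.
    by rewrite /s minimal_valuesP => -[q [w [mw ->]]]; exists q, w; split=> //; exact: hP.
  rewrite /C Ch; congr cone_of; apply/seteqP; split=> [c cs|_ [i _ <-]].
    by have /tnthP[i ->] : c \in in_tuple s by []; exists i.
  exact: mem_tnth.
- by rewrite /D /C Ch; exact: polyhedral_dual_cone.
- move=> g gP; have Cg := CE g gP; rewrite minimal_valuesP in Cg.
  split; first exact: Cg.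
  rewrite /D /C Cg dual_cone_of; apply/seteqP; split=> alpha /= aP.
    by move=> q w mw; apply: aP; exists q, w.
  by move=> _ [q [w [mw ->]]]; exact: aP.
Qed.
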